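(* Let $p\in(0,1)$ and let $\rho<\frac23$. There exist constants $c_7,c_8>0$ (depending on $p$ and $\rho$) such that whenever $n$ is large enough and $m\ge c_7 n$, the following holds. Fix any $T\subseteq\{1,\dots,m\}$ with $|T|\le\rho m$ and any choice of signs $\sigma_i\in\{-1,+1\}$, $i\in T$. Then with probability at least $1-e^{-c_8 n}$ an $m\times n$ random matrix $A$ with i.i.d. $N(0,1)$ entries has the following property: for every $f\in\mathbf{R}^n$ and every $e\in\mathbf{R}^m$ with support exactly $T$ and $\operatorname{sign}(e_i)=\sigma_i$ for all $i\in T$, setting $y=Af+e$, the vector $f$ is the unique solution of the minimization problem $\min_{x\in\mathbf{R}^n}\|y-Ax\|_p^p$.
   Context: For a vector $v$ and $p>0$, $\|v\|_p^p:=\sum_i|v_i|^p$. The support of $e$ is $\{i:e_i\ne0\}$. The support $T$ and the signs are fixed before $A$ is drawn (they do not depend on $A$), while the magnitudes $|e_i|>0$, $i\in T$, are arbitrary and may depend on $A$. *)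

(* Defs.v *)
From mathcomp Require Import all_boot all_order all_algebra.
From mathcomp Require Import all_classical all_reals all_analysis.

Set Implicit Arguments.
Unset Strict Implicit.
Unset Printing Implicit Defensive.

Import Order.TTheory GRing.Theory Num.Theory.

Local Open Scope ring_scope.

(* \|v\|_p^p; for p > 0 a zero entry contributes 0 `^ p = 0. *)
Definition lpp (R : realType) (p : R) (m : nat) (v : 'cV[R]_m) : R :=
  \sum_(i < m) `|v i ord0| `^ p.

Definition support_cV (R : realType) (m : nat) (e : 'cV[R]_m) : {set 'I_m} :=
  [set i | e i ord0 != 0]%SET.

Definition is_minimizer (R : realType) (V : Type) (F : V -> R) (x : V) : Prop :=
  forall z : V, F x <= F z.

Definition is_unique_minimizer (R : realType) (V : Type) (F : V -> R) (x : V) :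
    Prop :=
  is_minimizer F x /\ forall z : V, is_minimizer F z -> z = x.

Definition exact_recovery (R : realType) (p : R) (m n : nat)
    (T : {set 'I_m}) (sigma : 'I_m -> R) (A : 'M[R]_(m, n)) : Prop :=
  forall (f : 'cV[R]_n) (e : 'cV[R]_m),
    support_cV e = T ->
    (forall i, i \in T -> Num.sg (e i ord0) = sigma i) ->
    let y := A *m f + e in
    is_unique_minimizer (fun x : 'cV[R]_n => lpp p (y - A *m x)) f.

Definition mutually_independent (R : realType) (d : measure_display)
    (Omega : measurableType d) (P : probability Omega R) (I : finType)
    (X : I -> {RV P >-> R}) : Prop :=
  forall (J : {set I}) (B : I -> set R),
    (forall i, i \in J -> measurable (B i)) ->
    P (\bigcap_(i in [set` J]) (X i @^-1` B i))%classic =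
    (\prod_(i in J) P (X i @^-1` B i)%classic)%E.

Definition has_std_normal_law (R : realType) (d : measure_display)
    (Omega : measurableType d) (P : probability Omega R)
    (X : {RV P >-> R}) : Prop :=
  forall B : set R, measurable B -> distribution P X B = normal_prob 0 1 B.

Definition random_mx (R : realType) (d : measure_display)
    (Omega : measurableType d) (P : probability Omega R) (m n : nat)
    (X : 'I_m * 'I_n -> {RV P >-> R}) (w : Omega) : 'M[R]_(m, n) :=
  \matrix_(i < m, j < n) X (i, j) w.

Definition iid_std_normal (R : realType) (d : measure_display)
    (Omega : measurableType d) (P : probability Omega R) (I : finType)
    (X : I -> {RV P >-> R}) : Prop :=
  mutually_independent X /\ forall i, has_std_normal_law (X i).

(* "G holds with probability at least q": no measurability of G is presupposed;
   the bound is on a measurable event inside G. For measurable G this is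
   q <= P G. *)
Definition with_prob_at_least (R : realType) (d : measure_display)
    (Omega : measurableType d) (P : probability Omega R) (q : R)
    (G : Omega -> Prop) : Prop :=
  exists E : set Omega,
    [/\ measurable E, forall w, E w -> G w & (q%:E <= P E)%E].

(* Main.v *)
From HB Require Import structures.
Require Import Defs.
From mathcomp Require Import all_boot all_order all_algebra.
From mathcomp Require Import all_classical all_reals all_analysis.
From mathcomp Require Import measurable_realfun.
From mathcomp Require Import ring lra.

(* Writing [x = f - z], the minimum at [f] is strict as soon as, for every
   [z != 0], the sum of [|(A z)_i| `^ p] off [T] exceeds the sum over those
   [i] in [T] at which [A z] has the sign opposite to [sigma]: on [T],
   [|e + u| `^ p - |e| `^ p] is at least [0] when the signs agree and at least
   [- |u| `^ p] otherwise.  For a fixed [z] the entries of [A z] are independent,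
   identically distributed and symmetric, so half of [T] counts on average, and
   [rho / 2 < 1 - rho] leaves a drift proportional to [m].  Chernoff's bound
   turns the drift into an exponentially small failure probability, and a union
   bound over an exponential-size net of the unit ball, together with the
   [p]-subadditivity of [|.| `^ p], makes it uniform in [z].

   Only the moment generating function and the symmetry of the entries of [A z]
   are used, never their exact law. *)

Set Implicit Arguments.
Unset Strict Implicit.
Unset Printing Implicit Defensive.

Import Order.TTheory GRing.Theory Num.Theory.

Local Open Scope ring_scope.

(** * Entrywise loss *)

(** The net needs two tail estimates, not one. Moving from a net point [w] to a direction [x]
    changes the total loss by at most [lpp p (A *m (w - x))], and this error involves the same
    random matrix, so [lpp] must itself be bounded uniformly, by a multiple of [m]. A mesh with
    small [eps]^ p[then makes the error a small fraction of the drift.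
    With]M[the common]p[-th absolute moment of the entries of]A z[, the drift is]M * (m - 3/2 *
    #|T|)[: a row off]T[gains]M[, a row in]T[loses]M / 2[. The drift is useful only if]M[is bounded
    below uniformly over the net. Net points are not normalised, but those that matter have squared
    norm between 1/4 and 1, and comparing]cosh[with]|.| [^ p] turns the moment generating function
    into such a bound. All constants up to the mesh depend on [p] and [rho] alone; [c7] comes last,
    to beat the size of the net. *)

Lemma powR_subadditive (R : realType) (p a b : R) : 0 < p -> p <= 1 ->
  0 <= a -> 0 <= b -> (a + b) `^ p <= a `^ p + b `^ p.
Proof.
move=> p0 p1 a0 b0; have [s0|s0] := eqVneq (a + b) 0.
  by rewrite s0 powR0 ?gt_eqF// addr_ge0 ?powR_ge0.
have s_gt0 : 0 < a + b by rewrite lt0r s0 addr_ge0.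
(* After division by [a + b] both terms lie in [0, 1], where a power [p <= 1] can only increase
   them, and they add up to 1. *)
have frac x : 0 <= x -> x <= a + b -> x / (a + b) <= (x / (a + b)) `^ p.
  move=> x0 xs; have [->|xn0] := eqVneq x 0; first by rewrite mul0r powR_ge0.
  have x_gt0 : 0 < x by rewrite lt0r xn0.
  by rewrite ger1_powR// divr_gt0//= ler_pdivrMr// mul1r.
have scale x : 0 <= x -> x `^ p = (x / (a + b)) `^ p * (a + b) `^ p.
  by move=> x0; rewrite -powRM ?divr_ge0// ?ltW// divfK.
rewrite (scale a)// (scale b)// -mulrDl ler_peMl ?powR_ge0//.
have -> : 1 = a / (a + b) + b / (a + b) by rewrite -mulrDl divff.
by rewrite lerD// frac ?lerDl ?lerDr.
Qed.

Lemma powR_le_add_dist (R : realType) (p a b c : R) : 0 < p -> p <= 1 ->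
  0 <= a -> 0 <= b -> 0 <= c -> a <= b + c -> a `^ p <= b `^ p + c `^ p.
Proof.
move=> p0 p1 a0 b0 c0 abc; apply: le_trans (powR_subadditive p0 p1 b0 c0).
by rewrite ge0_ler_powR ?nnegrE ?addr_ge0// ltW.
Qed.

Definition neg_pow (R : realType) (p x : R) : R := (Num.max (- x) 0) `^ p.

(* The infimum of [`|e + x| `^ p - `|e| `^ p] over the admissible entries [e]:
   those of sign [s] when [b] holds, and [e = 0] otherwise. *)
Definition loss (R : realType) (p : R) (b : bool) (s x : R) : R :=
  if b then - neg_pow p (s * x) else `|x| `^ p.

Lemma neg_pow_add (R : realType) (p x : R) : 0 < p ->
  neg_pow p x + neg_pow p (- x) = `|x| `^ p.
Proof.
move=> p0; rewrite /neg_pow opprK; have [x0|x0] := leP 0 x.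
  by rewrite max_r ?oppr_le0// powR0 ?gt_eqF// add0r ger0_norm.
by rewrite max_l ?oppr_ge0 1?ltW// powR0 ?gt_eqF// addr0 ltr0_norm.
Qed.

(** Both branches apply [^ p], up to sign, to a 1-Lipschitz function of [x], and subadditivity makes
    [^ p] Hölder with constant 1. *)
Lemma loss_holder (R : realType) (p : R) (b : bool) (s x y : R) :
  0 < p -> p <= 1 -> `|s| = 1 ->
  loss p b s x <= loss p b s y + `|x - y| `^ p.
Proof.
move=> p0 p1 s1; rewrite /loss; case: b; last first.
  by apply: powR_le_add_dist => //; rewrite -{1}(subrK y x) addrC ler_normD.
rewrite lerNl opprD opprK lerBlDr; apply: powR_le_add_dist => //.
- by rewrite le_max lexx orbT.
- by rewrite le_max lexx orbT.
have : `|s * x - s * y| = `|x - y| by rewrite -mulrBr normrM s1 mul1r.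
move=> <-; rewrite ge_max.
have := ler_norm (s * x - s * y); have := normr_ge0 (s * x - s * y).
have : - (s * x) <= Num.max (- (s * x)) 0 by rewrite le_max lexx.
have : 0 <= Num.max (- (s * x)) 0 by rewrite le_max lexx orbT.
by move=> *; apply/andP; split; lra.
Qed.

Lemma loss_scale (R : realType) (p : R) (b : bool) (s c x : R) : 0 <= c ->
  loss p b s (c * x) = c `^ p * loss p b s x.
Proof.
move=> c0; rewrite /loss; case: b.
  rewrite mulrN; congr (- _); rewrite mulrCA /neg_pow -powRM//; last first.
    by rewrite le_max lexx orbT.
  by rewrite maxr_pMr// mulrN mulr0.
by rewrite normrM (ger0_norm c0) powRM.
Qed.

(** For [b] true, [s * (e + x) <= |e + x|] gives that [|e|] is at most [|e + x|] plus the negative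
    part of [s * x]. The magnitude of [e] drops out of the loss, which is why it may depend on the
    matrix. *)
Lemma loss_le (R : realType) (p : R) (b : bool) (s e x : R) :
  0 < p -> p <= 1 -> (if b then Num.sg e = s else e = 0) ->
  `|e| `^ p + loss p b s x <= `|e + x| `^ p.
Proof.
move=> p0 p1; rewrite /loss; case: b => [<-{s}|->]; last first.
  by rewrite normr0 powR0 ?gt_eqF// !add0r.
rewrite lerBlDr; apply: powR_le_add_dist => //.
  by rewrite le_max lexx orbT.
have : - (Num.sg e * x) <= Num.max (- (Num.sg e * x)) 0 by rewrite le_max lexx.
have : 0 <= Num.max (- (Num.sg e * x)) 0 by rewrite le_max lexx orbT.
have := ler_norm (e + x); have := ler_norm (- (e + x)); rewrite normrN.
by case: (sgrP e) => [->|e0|e0]; rewrite ?mul0r ?mul1r ?mulN1r ?opprK => *; lra.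
Qed.

(** * Reduction to a net *)

Definition total_loss (R : realType) (p : R) (m : nat) (T : {set 'I_m})
    (sigma : 'I_m -> R) (u : 'cV[R]_m) : R :=
  \sum_(i < m) loss p (i \in T) (sigma i) (u i ord0).

Lemma exact_recovery_of_total_loss_gt0 (R : realType) (p : R) (m n : nat)
    (T : {set 'I_m}) (sigma : 'I_m -> R) (A : 'M[R]_(m, n)) :
  0 < p -> p <= 1 -> (forall z, z != 0 -> 0 < total_loss p T sigma (A *m z)) ->
  exact_recovery p T sigma A.
Proof.
move=> p0 p1 pos f e eT es y.
have key x : lpp p (y - A *m f) + total_loss p T sigma (A *m (f - x)) <=
    lpp p (y - A *m x).
  rewrite /lpp -big_split/=; apply: ler_sum => i _.
  rewrite /y addrAC subrr add0r addrAC -mulmxBr [X in _ <= `|X| `^ _]mxE addrC.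
  rewrite [X in _ <= `|X| `^ _]addrC addrC; apply: loss_le => //.
  case: ifPn => iT; first exact: es.
  by apply/eqP; move: iT; rewrite -eT inE negbK.
split=> [x|x /(_ f) xf].
  apply: le_trans (key x); rewrite lerDl.
  have [->|xf] := eqVneq (f - x) 0; last exact/ltW/pos.
  rewrite mulmx0 sumr_ge0// => i _; rewrite /loss mxE normr0 mulr0.
  by rewrite /neg_pow oppr0 maxxx powR0 ?gt_eqF// oppr0; case: ifP.
apply/esym/eqP; rewrite -subr_eq0; apply: contraTT isT => /pos.
by have := le_trans (key x) xf; rewrite gerDl leNgt => /negPf ->.
Qed.

Definition sqnorm (R : realType) (n : nat) (z : 'cV[R]_n) : R :=
  \sum_(j < n) z j ord0 ^+ 2.

Lemma sqnorm_ge0 (R : realType) (n : nat) (z : 'cV[R]_n) : 0 <= sqnorm z.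
Proof. by apply: sumr_ge0 => j _; exact: sqr_ge0. Qed.

Lemma sqnorm_eq0 (R : realType) (n : nat) (z : 'cV[R]_n) :
  (sqnorm z == 0) = (z == 0).
Proof.
rewrite psumr_eq0 => [|j _]; last exact: sqr_ge0.
apply/allP/eqP => [z0|-> j _]; last by rewrite mxE expr0n eqxx.
apply/matrixP => j k; rewrite mxE (ord1 k); apply/eqP.
rewrite -sqrf_eq0; by have := z0 j; rewrite mem_index_enum => /(_ isT).
Qed.

Lemma sqnormZ (R : realType) (n : nat) (c : R) (z : 'cV[R]_n) :
  sqnorm (c *: z) = c ^+ 2 * sqnorm z.
Proof. by rewrite mulr_sumr; apply: eq_bigr => j _; rewrite mxE exprMn. Qed.

Lemma lppZ (R : realType) (p c : R) (m : nat) (u : 'cV[R]_m) : 0 <= c ->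
  lpp p (c *: u) = c `^ p * lpp p u.
Proof.
move=> c0; rewrite mulr_sumr; apply: eq_bigr => i _.
by rewrite mxE normrM (ger0_norm c0) powRM.
Qed.

Lemma total_lossZ (R : realType) (p c : R) (m : nat) (T : {set 'I_m})
    (sigma : 'I_m -> R) (u : 'cV[R]_m) : 0 <= c ->
  total_loss p T sigma (c *: u) = c `^ p * total_loss p T sigma u.
Proof.
move=> c0; rewrite mulr_sumr; apply: eq_bigr => i _.
by rewrite mxE loss_scale.
Qed.

Lemma lppD (R : realType) (p : R) (m : nat) (u v : 'cV[R]_m) :
  0 < p -> p <= 1 -> lpp p (u + v) <= lpp p u + lpp p v.
Proof.
move=> p0 p1; rewrite /lpp -big_split/=; apply: ler_sum => i _.
by rewrite mxE; apply: powR_le_add_dist => //; exact: ler_normD.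
Qed.

Lemma total_loss_le (R : realType) (p : R) (m : nat) (T : {set 'I_m})
    (sigma : 'I_m -> R) (u v : 'cV[R]_m) : 0 < p -> p <= 1 ->
  (forall i, i \in T -> `|sigma i| = 1) ->
  total_loss p T sigma u <= total_loss p T sigma v + lpp p (u - v).
Proof.
move=> p0 p1 s1; rewrite /lpp -big_split/=; apply: ler_sum => i _.
rewrite !mxE; have [iT|iT] := boolP (i \in T); first exact: loss_holder (s1 _ iT).
(* Off [T] nothing is assumed about [sigma i]; the sign 1 yields the same loss. *)
apply: (@loss_holder _ p false 1 (u i ord0) (v i ord0)) => //.
exact: normr1.
Qed.

(* The [lpp] bound on the net bootstraps to the whole ball: with [M] the
   supremum over the ball, subadditivity gives [M <= B + eps `^ p * M]. *)
Lemma lpp_le_of_net (R : realType) (p eps B : R) (m n : nat) (A : 'M[R]_(m, n))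
    (N : 'cV[R]_n -> Prop) : 0 < p -> p <= 1 -> 0 < eps -> eps `^ p <= 2^-1 ->
  (forall z, sqnorm z <= 1 ->
     exists2 w, N w & sqnorm w <= 1 /\ sqnorm (z - w) <= eps ^+ 2) ->
  (forall w, N w -> sqnorm w <= 1 -> lpp p (A *m w) <= B) ->
  forall z, sqnorm z <= 1 -> lpp p (A *m z) <= 2 * B.
Proof.
move=> p0 p1 e0 ep net bnd.
pose S := [set lpp p (A *m z) | z in [set z | sqnorm z <= 1]]%classic.
have z0 : sqnorm (0 : 'cV[R]_n) <= 1.
  by have /eqP -> : sqnorm (0 : 'cV[R]_n) == 0; rewrite ?sqnorm_eq0// ler01.
(* The supremum must be finite before it can be absorbed. Coordinates of a point of the ball are at
   most 1 in absolute value, so absolute row sums bound the entries of [A *m z]. *)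
have supS : has_sup S.
  split; first by exists (lpp p (A *m 0)); exists 0.
  exists (\sum_(i < m) (\sum_(j < n) `|A i j|) `^ p) => _ [z /= z1 <-].
  apply: ler_sum => i _; apply: ge0_ler_powR; rewrite ?nnegrE ?(ltW p0) ?sumr_ge0//.
  rewrite mxE; apply: le_trans (ler_norm_sum _ _ _) _; apply: ler_sum => j _.
  rewrite normrM ler_piMr//; apply: contraTT z1; rewrite -!ltNge => zj.
  rewrite /sqnorm (bigD1 j)//= -real_normK ?num_real//.
  rewrite ltr_wpDr ?sumr_ge0//; last by rewrite exprn_egt1.
  by move=> *; exact: sqr_ge0.
have leM z : sqnorm z <= 1 -> lpp p (A *m z) <= sup S.
  by move=> z1; apply: sup_upper_bound => //; exists z.
have M2 : sup S <= B + eps `^ p * sup S.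
  apply: ge_sup; first by case: supS.
  move=> _ [z /= z1 <-]; have [w Nw [w1 zw]] := net _ z1.
  rewrite -(subrK w z) addrC mulmxDr; apply: le_trans (lppD _ _ p0 p1) _.
  apply: lerD; first exact: bnd.
  have -> : z - w = eps *: (eps^-1 *: (z - w)).
    by rewrite scalerA divff ?gt_eqF// scale1r.
  rewrite -scalemxAr lppZ ?(ltW e0)// ler_wpM2l ?powR_ge0//; apply: leM.
  by rewrite sqnormZ exprVn ler_pdivrMl ?exprn_gt0// mulr1.
have M0 : 0 <= sup S by apply: le_trans (leM _ z0); exact: sumr_ge0.
move=> z /leM zM; apply: le_trans zM _.
have : eps `^ p * sup S <= 2^-1 * sup S by rewrite ler_wpM2r.
by move: M2; lra.
Qed.

Lemma total_loss_gt0_of_net (R : realType) (p eps B b : R) (m n : nat)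
    (A : 'M[R]_(m, n)) (T : {set 'I_m}) (sigma : 'I_m -> R)
    (N : 'cV[R]_n -> Prop) : 0 < p -> p <= 1 ->
  (forall i, i \in T -> `|sigma i| = 1) ->
  0 < eps -> eps <= 2^-1 -> eps `^ p <= 2^-1 -> 2 * B * eps `^ p <= b ->
  (forall z, sqnorm z <= 1 ->
     exists2 w, N w & sqnorm w <= 1 /\ sqnorm (z - w) <= eps ^+ 2) ->
  (forall w, N w -> sqnorm w <= 1 -> lpp p (A *m w) <= B) ->
  (forall w, N w -> 4^-1 <= sqnorm w -> sqnorm w <= 1 ->
     b < total_loss p T sigma (A *m w)) ->
  forall z, z != 0 -> 0 < total_loss p T sigma (A *m z).
Proof.
move=> p0 p1 s1 e0 e2 ep Bb net bndG bndF z zn0.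
have nz0 : 0 < sqnorm z by rewrite lt0r sqnorm_eq0 zn0 sqnorm_ge0.
pose c := Num.sqrt (sqnorm z); have c0 : 0 < c by rewrite sqrtr_gt0.
have -> : z = c *: (c^-1 *: z) by rewrite scalerA divff ?gt_eqF// scale1r.
rewrite -scalemxAr total_lossZ ?(ltW c0)// mulr_gt0 ?powR_gt0//.
set x := c^-1 *: z; have x1 : sqnorm x = 1.
  by rewrite sqnormZ exprVn sqr_sqrtr ?mulVf ?gt_eqF// ltW.
clearbody x; have [|w Nw [w1 xw]] := net x; first by rewrite x1.
(* [|x|^2 <= 2 |w|^2 + 2 |x - w|^2] with [|x| = 1] and [eps <= 1/2]; the coordinatewise certificate
   is the square of [a - 2 * d]. *)
have w4 : 4^-1 <= sqnorm w.
  have : sqnorm x <= 2 * sqnorm w + 2 * sqnorm (x - w).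
    rewrite /sqnorm !mulr_sumr -big_split/=; apply: ler_sum => j _.
    by rewrite !mxE; set a := x _ _; set d := w _ _; have := sqr_ge0 (a - 2 * d); lra.
  have : eps ^+ 2 <= 2^-1 ^+ 2 by rewrite lerXn2r ?nnegrE// ltW.
  by rewrite x1; move: xw; lra.
have d1 : lpp p (A *m (w - x)) <= 2 * B * eps `^ p.
  have -> : w - x = eps *: (eps^-1 *: (w - x)).
    by rewrite scalerA divff ?gt_eqF// scale1r.
  rewrite -scalemxAr lppZ ?(ltW e0)// mulrC ler_wpM2r ?powR_ge0//.
  apply: (lpp_le_of_net p0 p1 e0 ep net bndG).
  rewrite sqnormZ exprVn ler_pdivrMl ?exprn_gt0// mulr1.
  by rewrite -opprB -scaleN1r sqnormZ sqrrN expr1n mul1r.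
have := total_loss_le (A *m w) (A *m x) p0 p1 s1.
have := bndF _ Nw w4 w1; rewrite -mulmxBr.
by move: d1 Bb; lra.
Qed.

(** * A net of the unit ball *)

Lemma bin_le_exp2 (n k : nat) : ('C(n, k) <= 2 ^ n)%N.
Proof.
have [kn|nk] := leqP k n; last by rewrite bin_small.
rewrite -[2%N]/(1 + 1)%N expnDn (bigD1 (Ordinal (kn : (k < n.+1)%N)))//=.
by rewrite !exp1n !muln1 leq_addr.
Qed.

(* Rounding [z] towards 0 on the grid of mesh [1 / (q * sqrt n)] produces integer
   coordinates of total absolute value at most [q * n], so the net is counted
   by a binomial coefficient times a choice of signs. *)
Lemma ball_net (R : realType) (q n : nat) : (0 < q)%N -> (0 < n)%N ->
  exists N : seq 'cV[R]_n, (size N <= 2 ^ ((q + 2) * n))%N /\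
    forall z, sqnorm z <= 1 ->
      exists2 w, w \in N & sqnorm w <= 1 /\ sqnorm (z - w) <= q%:R^-1 ^+ 2.
Proof.
move=> q0 n0.
pose mesh : R := q%:R * Num.sqrt n%:R.
have sn0 : 0 < Num.sqrt n%:R :> R by rewrite sqrtr_gt0 ltr0n.
have mesh0 : 0 < mesh by rewrite mulr_gt0// ltr0n.
pose K := [set t : n.-tuple 'I_(q * n).+1 | (\sum_(i <- t) i <= q * n)%N]%SET.
pose pt (x : n.-tuple 'I_(q * n).+1 * {ffun 'I_n -> bool}) : 'cV[R]_n :=
  \col_j ((-1) ^+ x.2 j * ((tnth x.1 j : nat)%:R / mesh)).
exists [seq pt x | x <- enum (finset.setX K [set: {ffun 'I_n -> bool}]%SET)].
split.
  (* The binomial coefficient is at most [2 ^ (q * n + n)] and the signs contribute [2 ^ n], whence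
     the exponent [(q + 2) * n]. *)
  rewrite size_map -cardE cardsX card_partial_ord_partitions cardsT card_ffun.
  rewrite card_bool card_ord mulnDl mulnC mul2n -addnn addnA mulnC expnD.
  by rewrite leq_mul2r addnC bin_le_exp2 orbT.
move=> z z1.
pose k (j : 'I_n) := Num.truncn (mesh * `|z j ord0|).
have kP j : (k j)%:R <= mesh * `|z j ord0| < (k j).+1%:R.
  by rewrite truncn_itv// mulr_ge0// ltW.
have ksum : (\sum_(j < n) k j <= q * n)%N.
  rewrite -(ler_nat R) natr_sum; apply: (@le_trans _ _ (\sum_j mesh * `|z j ord0|)).
    by apply: ler_sum => j _; case/andP: (kP j).
  have sq2 : Num.sqrt n%:R ^+ 2 = n%:R :> R by rewrite sqr_sqrtr// ler0n.
  (* AM-GM on [sqrt n * |z_j|], in place of Cauchy-Schwarz: the sum is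
     [q * (n * sqnorm z + n) / 2 <= q * n]. *)
  apply: (@le_trans _ _ (\sum_(j < n) q%:R * (2^-1 * (n%:R * z j ord0 ^+ 2 + 1)))).
    apply: ler_sum => j _; rewrite /mesh -mulrA ler_wpM2l//.
    move: (Num.sqrt _) sq2 => S <-; rewrite -[z j ord0 ^+ 2]real_normK ?num_real//.
    have := sqr_ge0 (S * `|z j ord0| - 1); lra.
  rewrite -mulr_sumr natrM ler_wpM2l// -mulr_sumr big_split/= -mulr_sumr.
  rewrite sumr_const card_ord -/(sqnorm z).
  have : n%:R * sqnorm z <= n%:R * 1 by rewrite ler_wpM2l.
  lra.
have kle j : (k j < (q * n).+1)%N.
  by rewrite ltnS; apply: leq_trans ksum; rewrite (bigD1 j)//= leq_addr.
pose t := [tuple Ordinal (kle j) | j < n].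
pose s := [ffun j => z j ord0 < 0].
have ptE j : pt (t, s) j ord0 = (-1) ^+ (z j ord0 < 0)%R * ((k j)%:R / mesh).
  by rewrite mxE /= tnth_mktuple ffunE.
have zE j : z j ord0 = (-1) ^+ (z j ord0 < 0)%R * `|z j ord0|.
  by rewrite -realEsign ?num_real.
exists (pt (t, s)).
  apply/mapP; exists (t, s) => //; rewrite mem_enum inE /= !inE andbT.
  rewrite big_tuple; apply: leq_trans ksum; rewrite leq_eqVlt; apply/orP; left.
  by apply/eqP; apply: eq_bigr => j _; rewrite tnth_mktuple.
have kz j : 0 <= (k j)%:R / mesh <= `|z j ord0|.
  by rewrite divr_ge0// ?(ltW mesh0)//= ler_pdivrMr// mulrC; case/andP: (kP j).
have kz' j : `|z j ord0| - (k j)%:R / mesh <= mesh^-1.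
  rewrite lerBlDr -[X in X + _]mul1r -mulrDl ler_pdivlMr// mulrC.
  by case/andP: (kP j) => _ /ltW; rewrite -natr1 addrC.
(* Truncation shrinks every coordinate, so the rounded point stays in the ball; each of the [n]
   coordinates moves by at most [1 / (q * sqrt n)], so the squared distance is at most [1 / q^2]. *)
split.
  apply: le_trans z1; apply: ler_sum => j _; rewrite ptE exprMn sqrr_sign mul1r.
  rewrite -[z j ord0 ^+ 2]real_normK ?num_real//.
  by case/andP: (kz j) => ? ?; rewrite lerXn2r// nnegrE.
apply: (@le_trans _ _ (\sum_(j < n) mesh^-1 ^+ 2)).
  apply: ler_sum => j _; rewrite 2!mxE ptE.
  have -> : z j ord0 - (-1) ^+ (z j ord0 < 0)%R * ((k j)%:R / mesh) =
      (-1) ^+ (z j ord0 < 0)%R * (`|z j ord0| - (k j)%:R / mesh).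
    by rewrite mulrBr -zE.
  rewrite exprMn sqrr_sign mul1r; case/andP: (kz j) => ? ?.
  by rewrite lerXn2r ?nnegrE ?subr_ge0 ?invr_ge0 ?(ltW mesh0).
rewrite sumr_const card_ord /mesh invfM exprMn [X in _ * X]exprVn sqr_sqrtr//.
by rewrite -[X in X <= _]mulr_natr -mulrA mulVf ?mulr1// pnatr_eq0 -lt0n.
Qed.

(** * Independence *)

(** A pi-system generating the sigma-algebra of the variables [X i], [i \in J]. *)
Definition rectangles (R : realType) (d : measure_display)
    (Omega : measurableType d) (P : probability Omega R) (I : finType)
    (X : I -> {RV P >-> R}) (J : {set I}) : set (set Omega) :=
  [set A | exists2 B : I -> set R, (forall i, measurable (B i)) &
    A = \bigcap_(i in [set` J]) (X i @^-1` B i)]%classic.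

Lemma rectangles_setI (R : realType) (d : measure_display)
    (Omega : measurableType d) (P : probability Omega R) (I : finType)
    (X : I -> {RV P >-> R}) (J : {set I}) : setI_closed (rectangles X J).
Proof.
move=> _ _ [B mB ->] [C mC ->]; exists (fun i => B i `&` C i)%classic.
  by move=> i; exact: measurableI.
by rewrite -bigcapI; apply: eq_bigcapr => i _; rewrite preimage_setI.
Qed.

Lemma rectangles_measurable (R : realType) (d : measure_display)
    (Omega : measurableType d) (P : probability Omega R) (I : finType)
    (X : I -> {RV P >-> R}) (J : {set I}) :
  (rectangles X J `<=` measurable)%classic.
Proof.
move=> _ [B mB ->]; apply: fin_bigcap_measurable => // i _.
by rewrite -[X in measurable X]setTI; exact: measurable_funP.
Qed.

Lemma rectangles_setT (R : realType) (d : measure_display)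
    (Omega : measurableType d) (P : probability Omega R) (I : finType)
    (X : I -> {RV P >-> R}) (J : {set I}) : rectangles X J setT.
Proof.
exists (fun=> setT) => //.
by apply/esym; rewrite -subTset => w _ i _.
Qed.

Lemma sub_sigma_rectangles (R : realType) (d : measure_display)
    (Omega : measurableType d) (P : probability Omega R) (I : finType)
    (X : I -> {RV P >-> R}) (J : {set I}) :
  (<<s rectangles X J >> `<=` measurable)%classic.
Proof.
apply: smallest_sub; first exact: sigma_algebra_measurable.
exact: rectangles_measurable.
Qed.

(** [P] restricted to [B] and [P] scaled by [P B] are finite measures that agree on the pi-system
    [G], hence on the sigma-algebra it generates. *)
Lemma sigma_indep (R : realType) (d : measure_display)
    (Omega : measurableType d) (P : probability Omega R) (G : set (set Omega))
    (B : set Omega) :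
  setI_closed G -> G setT -> (G `<=` measurable)%classic -> measurable B ->
  (forall A, G A -> P (A `&` B)%classic = P A * P B)%E ->
  forall A, (<<s G >>)%classic A -> P (A `&` B)%classic = (P A * P B)%E.
Proof.
move=> GI GT Gm mB GB A sA.
pose m1 : {measure set Omega -> \bar R} := mrestr P mB.
have PBE : (fine (P B))%:E = P B by rewrite fineK// fin_num_measure.
have PB0 : 0 <= fine (P B) by rewrite fine_ge0.
pose m2 : {measure set Omega -> \bar R} := mscale (NngNum PB0) P.
have <- : m2 A = (P A * P B)%E by rewrite /m2/= /mscale/= PBE muleC.
apply: (g_sigma_algebra_measure_unique G _ (fun=> setT) _ _ m1 m2) => //.
- by rewrite bigcup_const.
- by move=> C GC; rewrite /m2 /= /mscale/= PBE muleC -GB.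
- by move=> _; rewrite /m1/= /mrestr setTI (le_lt_trans (probability_le1 _ _))// ltry.
Qed.

(** Two uses of [sigma_indep], one per argument, reduce to a pair of rectangles. Since [J] and [K]
    are disjoint, these paste into one rectangle over the union (the family [E]), whose probability
    factors by hypothesis. *)
Lemma disjoint_indep (R : realType) (d : measure_display)
    (Omega : measurableType d) (P : probability Omega R) (I : finType)
    (X : I -> {RV P >-> R}) (J K : {set I}) (A B : set Omega) :
  mutually_independent X -> [disjoint J & K] ->
  (<<s rectangles X J >>)%classic A -> (<<s rectangles X K >>)%classic B ->
  P (A `&` B)%classic = (P A * P B)%E.
Proof.
move=> indep JK sA sB; apply: sigma_indep sA => [||||{}A GA].
- exact: rectangles_setI.
- exact: rectangles_setT.
- exact: rectangles_measurable.
- exact: sub_sigma_rectangles sB.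
rewrite setIC muleC; apply: sigma_indep sB => [||||{}B GB].
- exact: rectangles_setI.
- exact: rectangles_setT.
- exact: rectangles_measurable.
- exact: rectangles_measurable GA.
case: GA GB => [C mC ->] [D mD ->].
rewrite muleC !indep//.
pose E i := if i \in J then C i else D i.
have -> : ((\bigcap_(i in [set` K]) X i @^-1` D i) `&`
    \bigcap_(i in [set` J]) X i @^-1` C i =
    \bigcap_(i in [set` (J :|: K)%SET]) X i @^-1` E i)%classic.
  apply/seteqP; split=> w /=.
    move=> [wD wC] i /=; rewrite inE /E; case: ifPn => [iJ _|_ /=]; first exact: wC.
    exact: wD.
  move=> wE; split=> i /= iJ; have := wE i; rewrite /= inE iJ ?orbT => /(_ isT).
    by rewrite /E; case: ifPn => // iJ'; rewrite (disjointFr JK iJ') in iJ.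
  by rewrite /E iJ.
rewrite indep; last by move=> i _; rewrite /E; case: ifP.
rewrite (big_setID J)/= finset.setUK; congr (_ * _)%E.
  by apply: eq_bigr => i iJ; rewrite /E iJ.
have -> : ((J :|: K) :\: J = K)%SET.
  apply/finset.setP => i; rewrite !inE; have [iJ|//] := boolP (i \in J).
  by rewrite (disjointFr JK iJ).
by apply: eq_bigr => i iK; rewrite /E (disjointFl JK iK).
Qed.

(** Measurability for the sigma-algebra generated by the [X i], [i \in J]; stated as
    [measurable_fun], it inherits closure under sums, products and composition. *)
Definition determined_by (R : realType) (d : measure_display)
    (Omega : measurableType d) (P : probability Omega R) (I : finType)
    (X : I -> {RV P >-> R}) (J : {set I}) (U : Omega -> R) : Prop :=
  @measurable_fun _ _ (g_sigma_algebraType (rectangles X J)) R setT U.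

Lemma measurable_EFin (R : realType) (d : measure_display)
    (T : measurableType d) (f : T -> R) :
  measurable_fun setT f -> measurable_fun setT (fun x => (f x)%:E).
Proof. by move=> mf; exact/measurable_EFinP. Qed.

Lemma integral_cst_probability (R : realType) (d : measure_display)
    (T : measurableType d) (P : probability T R) (c : R) :
  (\int[P]_x c%:E = c%:E)%E.
Proof.
rewrite integral_cst//= -[RHS]mule1; congr (_ * _)%E.
exact: probability_setT.
Qed.

Lemma determined_measurable (R : realType) (d : measure_display)
    (Omega : measurableType d) (P : probability Omega R) (I : finType)
    (X : I -> {RV P >-> R}) (J : {set I}) (U : Omega -> R) :
  determined_by X J U -> measurable_fun setT U.
Proof.
move=> mU mT B mB; apply: (sub_sigma_rectangles (X := X) (J := J)).
exact: mU.
Qed.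

Lemma determined_preimage (R : realType) (d : measure_display)
    (Omega : measurableType d) (P : probability Omega R) (I : finType)
    (X : I -> {RV P >-> R}) (J : {set I}) (U : Omega -> R) (B : set R) :
  determined_by X J U -> measurable B ->
  (<<s rectangles X J >>)%classic (U @^-1` B)%classic.
Proof. by move=> mU mB; have := mU measurableT _ mB; rewrite setTI. Qed.

Lemma rectangles_subset (R : realType) (d : measure_display)
    (Omega : measurableType d) (P : probability Omega R) (I : finType)
    (X : I -> {RV P >-> R}) (J K : {set I}) :
  J \subset K -> (rectangles X J `<=` rectangles X K)%classic.
Proof.
move=> /fintype.subsetP JK _ [B mB ->].
exists (fun i => if i \in J then B i else setT) => [i|]; first by case: ifP.
apply/seteqP; split=> w wB i /= iJ; first by case: ifP => //; exact: wB.
by have := wB i (JK i iJ); rewrite /= iJ.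
Qed.

Lemma determinedS (R : realType) (d : measure_display)
    (Omega : measurableType d) (P : probability Omega R) (I : finType)
    (X : I -> {RV P >-> R}) (J K : {set I}) (U : Omega -> R) :
  J \subset K -> determined_by X J U -> determined_by X K U.
Proof.
move=> JK mU mT B mB; have := mU measurableT B mB.
by apply: sub_smallest2r => //; exact: rectangles_subset.
Qed.

Lemma determined_coord (R : realType) (d : measure_display)
    (Omega : measurableType d) (P : probability Omega R) (I : finType)
    (X : I -> {RV P >-> R}) (i : I) : determined_by X [set i]%SET (X i).
Proof.
move=> mT B mB; rewrite setTI; apply: sub_sigma_algebra.
exists (fun=> B) => //.
apply/seteqP; split=> w wB; first by move=> j /=; rewrite inE => /eqP ->.
by apply: (wB i); rewrite /= inE.
Qed.

Lemma determined_comp (R : realType) (d : measure_display)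
    (Omega : measurableType d) (P : probability Omega R) (I : finType)
    (X : I -> {RV P >-> R}) (J : {set I}) (U : Omega -> R) (f : R -> R) :
  measurable_fun setT f -> determined_by X J U -> determined_by X J (f \o U).
Proof. by move=> mf mU; exact: measurableT_comp. Qed.

Lemma determined_sum (R : realType) (d : measure_display)
    (Omega : measurableType d) (P : probability Omega R) (I : finType)
    (X : I -> {RV P >-> R}) (J : {set I}) (L : Type) (s : seq L)
    (U : L -> Omega -> R) :
  (forall l, determined_by X J (U l)) ->
  determined_by X J (fun w => \sum_(l <- s) U l w).
Proof. by move=> mU; exact: measurable_sum. Qed.

Lemma determined_prod (R : realType) (d : measure_display)
    (Omega : measurableType d) (P : probability Omega R) (I : finType)
    (X : I -> {RV P >-> R}) (J : {set I}) (L : eqType) (s : seq L)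
    (U : L -> Omega -> R) :
  (forall l, l \in s -> determined_by X J (U l)) ->
  determined_by X J (fun w => \prod_(l <- s) U l w).
Proof. by move=> mU; exact: measurable_prod. Qed.

(** By independence the law of the pair [(U, V)] agrees with the product of the two laws on
    measurable rectangles, hence everywhere; Tonelli then iterates the integral. *)
Lemma integral_indep (R : realType) (d : measure_display)
    (Omega : measurableType d) (P : probability Omega R) (I : finType)
    (X : I -> {RV P >-> R}) (J K : {set I}) (U V : Omega -> R)
    (F : R * R -> \bar R) :
  mutually_independent X -> [disjoint J & K] ->
  determined_by X J U -> determined_by X K V ->
  measurable_fun setT F -> (forall x, 0 <= F x)%E ->
  (\int[P]_w F (U w, V w) = \int[P]_w \int[P]_w' F (U w, V w'))%E.
Proof.
move=> indep JK dU dV mF F0.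
have mU := determined_measurable dU; have mV := determined_measurable dV.
pose U' : {mfun Omega >-> R} := HB.pack U (isMeasurableFun.Build _ _ _ _ _ mU).
pose V' : {mfun Omega >-> R} := HB.pack V (isMeasurableFun.Build _ _ _ _ _ mV).
have mW : measurable_fun setT (fun w => (U w, V w)).
  exact: measurable_fun_pair.
pose W' : {mfun Omega >-> (R * R)%type} :=
  HB.pack (fun w => (U w, V w)) (isMeasurableFun.Build _ _ _ _ _ mW).
have joint A : measurable A ->
    (distribution P U' \x distribution P V')%E A = distribution P W' A.
  apply: product_measure_unique => B C mB mC.
  exact: disjoint_indep indep JK (determined_preimage dU mB)
    (determined_preimage dV mC).
transitivity (\int[distribution P W']_x F x)%E.
  by rewrite ge0_integral_distribution.
transitivity (\int[distribution P U' \x distribution P V']_x F x)%E.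
  by apply: eq_measure_integral => A mA _; exact/esym/joint.
rewrite fubini_tonelli1// ge0_integral_distribution/=; last 2 first.
- exact: measurable_fun_fubini_tonelli_F.
- by move=> x; exact: integral_ge0.
apply: eq_integral => w _ /=; rewrite /fubini_F.
rewrite (ge0_integral_distribution V')//.
exact: measurableT_comp.
Qed.

Lemma integral_indep_mul (R : realType) (d : measure_display)
    (Omega : measurableType d) (P : probability Omega R) (I : finType)
    (X : I -> {RV P >-> R}) (J K : {set I}) (U V : Omega -> R) :
  mutually_independent X -> [disjoint J & K] ->
  determined_by X J U -> determined_by X K V ->
  (forall w, 0 <= U w) -> (forall w, 0 <= V w) ->
  (\int[P]_w (U w * V w)%:E = \int[P]_w (U w)%:E * \int[P]_w (V w)%:E)%E.
Proof.
move=> indep JK dU dV U0 V0.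
have mU := determined_measurable dU; have mV := determined_measurable dV.
(* The absolute values make [F] nonnegative on the whole plane, as [integral_indep] asks, without
   changing it at the values of [U] and [V]. *)
pose F (x : R * R) : \bar R := (`|x.1| * `|x.2|)%:E.
transitivity (\int[P]_w F (U w, V w))%E.
  by apply: eq_integral => w _; rewrite /F/= !ger0_norm.
have mF : measurable_fun setT F.
  rewrite /F; apply: measurable_EFin; apply: measurable_funM.
    by apply: measurableT_comp => //; exact: measurable_fst.
  by apply: measurableT_comp => //; exact: measurable_snd.
have F0 x : (0 <= F x)%E by rewrite lee_fin mulr_ge0.
rewrite (integral_indep indep JK dU dV mF F0).
have VI0 : (0 <= \int[P]_w (V w)%:E)%E by apply: integral_ge0 => w _; rewrite lee_fin.
rewrite -ge0_integralZr//; last 2 first.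
- exact: measurable_EFin.
- by move=> w _; rewrite lee_fin.
apply: eq_integral => w _; rewrite -ge0_integralZl//; first last.
- by rewrite lee_fin.
- by move=> ? _; rewrite lee_fin.
- exact: measurable_EFin.
by apply: eq_integral => w' _; rewrite /F/= !ger0_norm.
Qed.

Lemma integral_indep_prod (R : realType) (d : measure_display)
    (Omega : measurableType d) (P : probability Omega R) (I : finType)
    (X : I -> {RV P >-> R}) (L : finType) (J : L -> {set I})
    (U : L -> Omega -> R) :
  mutually_independent X -> (forall k l, k != l -> [disjoint J k & J l]) ->
  (forall l, determined_by X (J l) (U l)) -> (forall l w, 0 <= U l w) ->
  (\int[P]_w (\prod_l U l w)%:E = \prod_l \int[P]_w (U l w)%:E)%E.
Proof.
move=> indep disj dU U0.
elim: (index_enum L) (index_enum_uniq L) => [_|l s IH /=/andP[ls us]].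
  under eq_integral do rewrite big_nil.
  by rewrite big_nil integral_cst_probability.
under eq_integral do rewrite big_cons.
rewrite big_cons -IH//.
pose K := (\bigcup_(k in [set k in s]) J k)%SET.
apply: (@integral_indep_mul _ _ _ _ _ X (J l) K) => //.
- rewrite /K bigcup_disjoint// => k; rewrite inE => ks.
  by apply: disj; apply: contraNneq ls => ->.
- apply: determined_prod => k ks; apply: determinedS (dU k).
  by apply: finset.bigcup_sup; rewrite inE.
- by move=> w; apply: prodr_ge0.
Qed.

(** * The normal law *)

Lemma lebesgue_measure_opp (R : realType) (A : set (measurableTypeR R)) : measurable A ->
  lebesgue_measure (-%R @^-1` A)%classic = lebesgue_measure A :> \bar R.
Proof.
move=> mA.
have mopp : measurable_fun setT (-%R : measurableTypeR R -> measurableTypeR R).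
  exact: oppr_measurable.
pose mu : {measure set (measurableTypeR R) -> \bar R} :=
  pushforward lebesgue_measure (-%R : measurableTypeR R -> measurableTypeR R).
suff H : forall B, measurable B -> lebesgue_measure B = mu mopp B.
  by apply/esym; exact: H.
apply: lebesgue_measure_unique => _ [[a b] _ <-]; rewrite /mu /= /pushforward /=.
have -> : (-%R @^-1` `]a, b] = `[- b, - a[ :> set R)%classic.
  by apply/seteqP; split=> x /=; rewrite !in_itv/= => /andP[? ?]; apply/andP; split; lra.
rewrite !lebesgue_measure_itv/= !lte_fin ltrN2; case: ifP => // ab.
by rewrite -!EFinD opprK addrC.
Qed.

Lemma normal_pdf01E (R : realType) (x m : R) :
  normal_pdf m 1 x = normal_peak 1 * expR (- (x - m) ^+ 2 / 2).
Proof. by rewrite normal_pdfE ?oner_neq0// /normal_fun expr1n. Qed.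

Lemma normal_prob_opp (R : realType) (A : set R) : measurable A ->
  normal_prob 0 1 (-%R @^-1` A)%classic = normal_prob 0 1 A :> \bar R.
Proof.
move=> mA.
have mopp : measurable_fun setT (-%R : measurableTypeR R -> measurableTypeR R).
  exact: oppr_measurable.
have even x : normal_pdf 0 1 (- x) = normal_pdf 0 1 x :> R.
  by rewrite !normal_pdf01E !subr0 sqrrN.
rewrite /normal_prob.
pose f (x : measurableTypeR R) : \bar R := (normal_pdf 0 1 x)%:E.
have mf : measurable_fun A f.
  by apply: measurable_funTS; apply: measurable_EFin; exact: measurable_normal_pdf.
have f0 : {in A, forall x, (0 <= f x)%E}.
  by move=> x _; rewrite lee_fin normal_pdf_ge0.
transitivity (\int[pushforward lebesgue_measure
    (-%R : measurableTypeR R -> measurableTypeR R)]_(x in A) f x)%E; last first.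
  apply: eq_measure_integral => B mB _.
  exact: lebesgue_measure_opp.
rewrite (ge0_integral_pushforward mopp _ mA mf f0).
apply: eq_integral => x _.
by rewrite /f /= even.
Qed.

(** The Radon-Nikodym derivative of [normal_prob] and [normal_pdf] have the same integral over every
    measurable set, so they agree almost everywhere. *)
Lemma integral_normal_prob (R : realType) (m s : R) (f : R -> \bar R) :
  measurable_fun setT f -> (forall x, 0 <= f x)%E ->
  (\int[normal_prob m s]_x f x =
   \int[lebesgue_measure]_x (f x * (normal_pdf m s x)%:E))%E.
Proof.
move=> mf f0; have dom := @normal_prob_dominates R m s.
rewrite -(Radon_Nikodym_SigmaFinite.change_of_variables dom)//.
apply: ae_eq_integral => //.
- apply: emeasurable_funM => //.
  exact: measurable_int (Radon_Nikodym_SigmaFinite.f_integrable dom).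
- apply: emeasurable_funM => //; apply: measurable_EFin.
  exact: measurable_normal_pdf.
- apply: ae_eqe_mul2l; apply: integral_ae_eq => //.
  + exact: Radon_Nikodym_SigmaFinite.f_integrable.
  + apply: measurable_EFin; exact: measurable_normal_pdf.
  + by move=> A _ mA; rewrite -(Radon_Nikodym_SigmaFinite.f_integral dom).
Qed.

Lemma measurable_expRM (R : realType) (c : R) :
  measurable_fun setT (fun x : R => expR (c * x)).
Proof. exact: measurableT_comp (@measurable_expR R) (mulrl_measurable c). Qed.

Lemma normal_mgf (R : realType) (t : R) :
  (\int[normal_prob 0 1]_x (expR (t * x))%:E = (expR (t ^+ 2 / 2))%:E)%E.
Proof.
rewrite integral_normal_prob; last 2 first.
- by apply: measurable_EFin; exact: measurable_expRM.
- by move=> x; rewrite lee_fin expR_ge0.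
(* Completing the square: [expR (t * x)] times the density centred at 0 is [expR (t ^+ 2 / 2)] times
   the density centred at [t]. *)
transitivity (\int[lebesgue_measure]_x
    ((expR (t ^+ 2 / 2))%:E * (normal_pdf t 1 x)%:E) : \bar R)%E.
  apply: eq_integral => x _; rewrite -!EFinM !normal_pdf01E; congr EFin.
  rewrite mulrCA [RHS]mulrCA -!expRD; by congr (_ * expR _); field.
pose f (x : measurableTypeR R) : \bar R := (normal_pdf t 1 x)%:E.
have mf : measurable_fun setT f.
  by apply: measurable_EFin; exact: measurable_normal_pdf.
have f0 : forall x, setT x -> (0 <= f x)%E.
  by move=> ? _; rewrite lee_fin normal_pdf_ge0.
have k0 : (0 <= (expR (t ^+ 2 / 2))%:E :> \bar R)%E by rewrite lee_fin expR_ge0.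
have := ge0_integralZl lebesgue_measure measurableT mf f0 k0.
by rewrite [X in _ = (_ * X)%E]integral_normal_pdf mule1.
Qed.

(** * Linear combinations of independent normal variables *)

(** Equality in distribution, tested on nonnegative functions so that it combines with Tonelli
    without integrability conditions. *)
Definition same_law (R : realType) (d : measure_display)
    (Omega : measurableType d) (P : probability Omega R) (U V : Omega -> R) :
    Prop :=
  forall phi : R -> \bar R, measurable_fun setT phi -> (forall x, 0 <= phi x)%E ->
    (\int[P]_w phi (U w) = \int[P]_w phi (V w))%E.

(* [normal_prob] lives on [measurableTypeR R], whose display is not that of [R]:
   [id] transports it. *)
Lemma integral_std_normal_law (R : realType) (d : measure_display)
    (Omega : measurableType d) (P : probability Omega R) (X : {RV P >-> R})
    (f : R -> \bar R) :
  has_std_normal_law X -> measurable_fun setT f -> (forall x, 0 <= f x)%E ->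
  (\int[P]_w f (X w) = \int[normal_prob 0 1]_x f x)%E.
Proof.
move=> lX mf f0; rewrite -(ge0_integral_distribution X mf f0).
have mid : measurable_fun setT (id : measurableTypeR R -> R).
  by move=> _ B mB; rewrite setTI.
rewrite -[RHS](ge0_integral_pushforward mid _ measurableT mf) => [|x _]//.
by apply: eq_measure_integral => A mA _; exact: lX.
Qed.

Lemma integral_normal_prob_opp (R : realType) (f : R -> \bar R) :
  measurable_fun setT f -> (forall x, 0 <= f x)%E ->
  (\int[normal_prob 0 1]_x f (- x)%R = \int[normal_prob 0 1]_x f x)%E.
Proof.
move=> mf f0.
have mopp : measurable_fun setT (-%R : measurableTypeR R -> measurableTypeR R).
  exact: oppr_measurable.
have mf' : measurable_fun setT (f : measurableTypeR R -> \bar R) by exact: mf.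
have := ge0_integral_pushforward mopp (normal_prob 0 1) measurableT mf'.
move=> <- => [|x _]//.
by apply: eq_measure_integral => A mA _; exact: normal_prob_opp.
Qed.

Lemma same_law_std_normal (R : realType) (d : measure_display)
    (Omega : measurableType d) (P : probability Omega R) (X Y : {RV P >-> R})
    (s c : R) :
  has_std_normal_law X -> has_std_normal_law Y -> s = -1 \/ s = 1 ->
  same_law P (fun w => c * X w) (fun w => s * c * Y w).
Proof.
move=> lX lY s1 phi mphi phi0.
have mM a : measurable_fun setT (fun x : R => phi (a * x)).
  by apply: measurableT_comp => //; exact: mulrl_measurable.
have normalE (Z : {RV P >-> R}) a : has_std_normal_law Z ->
    (\int[P]_w phi (a * Z w)%R = \int[normal_prob 0 1]_x phi (a * x)%R)%E.
  move=> lZ; exact: (integral_std_normal_law lZ (mM a)).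
rewrite normalE// (normalE Y)//; case: s1 => ->; last by rewrite mul1r.
rewrite -(integral_normal_prob_opp (mM c))//.
by apply: eq_integral => x _; rewrite mulrN mulN1r mulNr.
Qed.

Lemma determined_scale (R : realType) (d : measure_display)
    (Omega : measurableType d) (P : probability Omega R) (I : finType)
    (X : I -> {RV P >-> R}) (J : {set I}) (i : I) (c : R) :
  i \in J -> determined_by X J (fun w => c * X i w).
Proof.
move=> iJ; apply: (determinedS (J := [set i]%SET)); first by rewrite finset.sub1set.
apply: (determined_comp (f := fun x => c * x)); last exact: determined_coord.
exact: mulrl_measurable.
Qed.

Lemma determined_lincomb (R : realType) (d : measure_display)
    (Omega : measurableType d) (P : probability Omega R) (I : finType)
    (X : I -> {RV P >-> R}) (L : finType) (f : L -> I) (a : L -> R) (s : seq L) :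
  determined_by X [set f l | l in s]%SET
    (fun w => \sum_(l <- s) a l * X (f l) w).
Proof.
(* [determined_sum] wants every term determined, even at indices outside [s]; those get coefficient
   0. *)
rewrite (_ : (fun w => _) =
    fun w => \sum_(l <- s) (if l \in s then a l else 0) * X (f l) w); last first.
  by apply/funext => w; apply: eq_big_seq => l ->.
apply: determined_sum => l; case: ifPn => ls.
  by apply: determined_scale; apply/imsetP; exists l.
rewrite (_ : (fun w => _) = cst 0); first exact: measurable_cst.
by apply/funext => w; rewrite mul0r.
Qed.

(** Summands are exchanged one at a time: with the head frozen, induction changes the tail; the tail
    integrated out, [ab] changes the head. Injectivity keeps the head independent of the tail. *)
Lemma same_law_lincomb (R : realType) (d : measure_display)
    (Omega : measurableType d) (P : probability Omega R) (I : finType)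
    (X : I -> {RV P >-> R}) (L : finType) (f g : L -> I) (a b : L -> R) :
  mutually_independent X -> injective f -> injective g ->
  (forall l, same_law P (fun w => a l * X (f l) w) (fun w => b l * X (g l) w)) ->
  same_law P (fun w => \sum_l a l * X (f l) w) (fun w => \sum_l b l * X (g l) w).
Proof.
move=> indep finj ginj ab.
elim: (index_enum L) (index_enum_uniq L) => [_|l s IH /=/andP[ls us]].
  by move=> phi _ _; apply: eq_integral => w _; rewrite !big_nil.
move=> phi mphi phi0.
have split (h : L -> I) (c : L -> R) : injective h ->
    (\int[P]_w phi (\sum_(k <- l :: s) c k * X (h k) w)%R =
     \int[P]_w \int[P]_w' phi (c l * X (h l) w + \sum_(k <- s) c k * X (h k) w')%R)%E.
  move=> hinj; under eq_integral do rewrite big_cons.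
  have := @integral_indep _ _ _ _ _ X [set h l]%SET [set h k | k in s]%SET
    (fun w => c l * X (h l) w) (fun w => \sum_(k <- s) c k * X (h k) w)
    (fun x => phi (x.1 + x.2)).
  apply => //=; last 1 first.
  - apply: measurableT_comp => //.
    by apply: measurable_funD; [exact: measurable_fst|exact: measurable_snd].
  - rewrite disjoints1; apply: contra ls => /imsetP[k ks /hinj ->//].
  - by apply: determined_scale; rewrite inE.
  - exact: determined_lincomb.
have mshift u : measurable_fun setT (fun v : R => phi (u + v)).
  by apply: measurableT_comp => //; exact: measurable_funD.
rewrite (split f a finj) (split g b ginj).
have dg : determined_by X [set g k | k in s]%SET
    (fun w => \sum_(k <- s) b k * X (g k) w) by exact: determined_lincomb.
have mg := determined_measurable dg.
pose psi u := (\int[P]_w' phi (u + \sum_(k <- s) b k * X (g k) w')%R)%E.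
have IHs u : (\int[P]_w' phi (u + \sum_(k <- s) a k * X (f k) w')%R = psi u)%E.
  by apply: (IH us _ (mshift u)) => v; exact: phi0.
under eq_integral do rewrite IHs.
apply: (ab l psi); last by move=> u; exact: integral_ge0.
pose F (x : R * Omega) := phi (x.1 + \sum_(k <- s) b k * X (g k) x.2).
apply: (measurable_fun_fubini_tonelli_F F); last by move=> x; exact: phi0.
apply: measurableT_comp => //; apply: measurable_funD; first exact: measurable_fst.
by apply: measurableT_comp mg _; exact: measurable_snd.
Qed.

Lemma lincomb_mgf (R : realType) (d : measure_display)
    (Omega : measurableType d) (P : probability Omega R) (I : finType)
    (X : I -> {RV P >-> R}) (L : finType) (f : L -> I) (a : L -> R) (t : R) :
  iid_std_normal X -> injective f ->
  (\int[P]_w (expR (t * \sum_l a l * X (f l) w)%R)%:E =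
   (expR (t ^+ 2 / 2 * \sum_l a l ^+ 2)%R)%:E)%E.
Proof.
move=> [indep lX] finj.
under eq_integral => w _ do rewrite mulr_sumr expR_sum.
have := @integral_indep_prod _ _ _ P _ X L (fun l => [set f l]%SET)
  (fun l w => expR (t * (a l * X (f l) w))).
move=> -> //.
- transitivity (\prod_l (expR ((t * a l) ^+ 2 / 2))%:E)%E.
    apply: eq_bigr => l _; rewrite -normal_mgf.
    rewrite -(integral_std_normal_law (lX (f l)))/=.
    + by apply: eq_integral => w _ /=; rewrite mulrA.
    + by apply: measurable_EFin; exact: measurable_expRM.
    + by move=> x; rewrite lee_fin expR_ge0.
  rewrite prodEFin -expR_sum mulr_sumr; congr (expR _)%:E.
  by apply: eq_bigr => l _; rewrite exprMn mulrAC.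
- move=> k l kl; rewrite disjoints1 inE; apply: contraNneq kl => /finj ->.
  by rewrite eqxx.
- move=> l; apply: (determined_comp (f := fun x => expR (t * x))).
    exact: measurable_expRM.
  by apply: determined_scale; rewrite inE.
Qed.

(** * Exponential moments of one row *)

Lemma powR_le_1D (R : realType) (p x : R) : 0 < p -> p <= 1 -> 0 <= x ->
  x `^ p <= 1 + x.
Proof.
move=> p0 p1 x0; have [x1|x1] := leP x 1.
  rewrite ler_wpDr//; apply: le_trans (_ : 1 `^ p <= 1); last by rewrite powR1.
  by rewrite ge0_ler_powR ?nnegrE// ltW.
by apply: le_trans (ler1_powR (ltW x1) p1) _; rewrite lerDr.
Qed.

Lemma expR_norm_le (R : realType) (x : R) : expR `|x| <= expR x + expR (- x).
Proof.
have [x0|x0] := leP 0 x; first by rewrite ger0_norm// lerDl expR_ge0.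
by rewrite ltr0_norm// lerDr expR_ge0.
Qed.

(** After multiplication by [1 + x] the left side is at most 1 and the right side is
    [1 + x ^+ 3]. *)
Lemma expRN_le_quadratic (R : realType) (x : R) : 0 <= x ->
  expR (- x) <= 1 - x + x ^+ 2.
Proof.
move=> x0; have e1 : (1 + x) * expR (- x) <= 1.
  rewrite -[leRHS](expRxMexpNx_1 x) ler_wpM2r ?expR_ge0//; exact: expR_ge1Dx.
have x1 : 0 < 1 + x by rewrite ltr_wpDr.
rewrite -(ler_pM2l x1); apply: le_trans e1 _.
have -> : (1 + x) * (1 - x + x ^+ 2) = 1 + x ^+ 3 by ring.
by rewrite lerDl exprn_ge0.
Qed.

(** [expR x <= 1 + x * expR x], inserted into itself once. *)
Lemma expR_le_quadratic (R : realType) (x : R) : 0 <= x ->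
  expR x <= 1 + x + x ^+ 2 * expR x.
Proof.
move=> x0.
have e1 : expR x * (1 - x) <= 1.
  rewrite -[leRHS](expRxMexpNx_1 x) ler_wpM2l ?expR_ge0//; exact: expR_ge1Dx.
by move: (expR x) (expR_ge0 x) e1 => e; nra.
Qed.

Lemma sqr_le_expR (R : realType) (x : R) : 0 <= x -> x ^+ 2 <= expR (2 * x).
Proof.
move=> x0; rewrite expRM_natl lerXn2r ?nnegrE ?expR_ge0//.
by apply: le_trans (expR_ge1Dx x); rewrite lerDr.
Qed.

(* Where [cosh u] is large, [cosh (2 * u)] dominates it; elsewhere [|u|] is
   bounded and [cosh u - 1] is controlled by [|u| `^ p]. *)
Lemma cosh_le_powR (R : realType) (p eta u : R) : 0 < p -> p <= 1 -> 0 < eta ->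
  expR u + expR (- u) <= 2 + (eta^-1 + 1) * `|u| `^ p
    + eta * (expR (2 * u) + expR (- (2 * u))).
Proof.
move=> p0 p1 e0; set c := expR u + expR (- u).
have -> : expR (2 * u) + expR (- (2 * u)) = c ^+ 2 - 2.
  rewrite -mulrN !expRM_natl /c sqrrD; have := expRxMexpNx_1 u.
  by move: (expR u) (expR (- u)) => a b ->; ring.
have c2 : 2 <= c.
  by rewrite /c; have := expR_ge1Dx u; have := expR_ge1Dx (- u); lra.
have ei : eta * eta^-1 = 1 by rewrite divff ?gt_eqF.
have ei0 : 0 < eta^-1 by rewrite invr_gt0.
have y0 := powR_ge0 `|u| p; set y := `|u| `^ p in y0 *.
(* Above this threshold [eta * c ^+ 2 >= c + eta * c], and [c >= 2] finishes. *)
have [cB|cB] := leP c (eta^-1 + 1); last first.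
  have : 0 <= eta * (c - 2) by rewrite mulr_ge0 ?subr_ge0// ltW.
  have : 0 <= (eta^-1 + 1) * y by rewrite mulr_ge0// ltW// addr_gt0.
  have : eta * (eta^-1 + 1) * c <= eta * c * c.
    by rewrite -!mulrA ler_pM2l// ler_wpM2r// ?ltW//; lra.
  have -> : eta * (eta^-1 + 1) * c = c + eta * c.
    by rewrite [eta * (_ + 1)]mulrDr ei mulr1 mulrDl mul1r.
  by lra.
have cu : c - 2 <= `|u| * c.
  have : expR `|u| <= c by exact: expR_norm_le.
  have : c <= expR `|u| + 1.
    rewrite /c; have [u0|u0] := leP 0 u.
      by rewrite ger0_norm// lerD2l -expR0 ler_expR oppr_le0.
    by rewrite ltr0_norm// addrC lerD2l -expR0 ler_expR ltW.
  have e1 : expR `|u| * (1 - `|u|) <= 1.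
    by rewrite -[leRHS](expRxMexpNx_1 `|u|) ler_wpM2l ?expR_ge0//; exact: expR_ge1Dx.
  by move: (normr_ge0 u) e1; move: `|u| (expR _) => v e; nra.
have : c - 2 <= (eta^-1 + 1) * y.
  have [u1|u1] := leP `|u| 1.
    have [u00|un0] := eqVneq u 0.
      rewrite u00 normr0 mul0r in cu; apply: le_trans cu _.
      by rewrite mulr_ge0// ltW// addr_gt0.
    have : `|u| <= y by rewrite ger1_powR// normr_gt0 un0.
    by move: (normr_ge0 u); nra.
  have : 1 `^ p <= y.
    by apply: ge0_ler_powR; rewrite ?nnegrE ?normr_ge0 ?ler01 ?(ltW p0) ?(ltW u1).
  rewrite powR1.
  by nra.
have : 0 <= eta * (c ^+ 2 - 2) by rewrite mulr_ge0 ?ltW//; nra.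
lra.
Qed.

Lemma integral_affine (R : realType) (d : measure_display)
    (Omega : measurableType d) (P : probability Omega R) (f g : Omega -> R)
    (a b c : R) : measurable_fun setT f -> measurable_fun setT g ->
  (forall w, 0 <= f w) -> (forall w, 0 <= g w) -> 0 <= a -> 0 <= b -> 0 <= c ->
  (\int[P]_w (a + b * f w + c * g w)%:E =
   a%:E + b%:E * \int[P]_w (f w)%:E + c%:E * \int[P]_w (g w)%:E)%E.
Proof.
move=> mf mg f0 g0 a0 b0 c0.
have mb : measurable_fun setT (fun w => b * f w).
  by apply: measurableT_comp mf => //; exact: mulrl_measurable.
have mc : measurable_fun setT (fun w => c * g w).
  by apply: measurableT_comp mg => //; exact: mulrl_measurable.
have mab : measurable_fun setT (fun w => a + b * f w).
  by apply: measurable_funD => //; exact: measurable_cst.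
under eq_integral do rewrite EFinD.
rewrite ge0_integralD//; first last.
- exact: measurable_EFin.
- by move=> w _; rewrite lee_fin mulr_ge0.
- exact: measurable_EFin.
- by move=> w _; rewrite lee_fin addr_ge0// mulr_ge0.
congr (_ + _)%E; last first.
  under eq_integral do rewrite EFinM.
  rewrite ge0_integralZl//; first exact: measurable_EFin.
  by move=> w _; rewrite lee_fin.
under eq_integral do rewrite EFinD.
rewrite ge0_integralD//; first last.
- exact: measurable_EFin.
- by move=> w _; rewrite lee_fin mulr_ge0.
rewrite integral_cst_probability; congr (_ + _)%E.
under eq_integral do rewrite EFinM.
rewrite ge0_integralZl//; first exact: measurable_EFin.
by move=> w _; rewrite lee_fin.
Qed.

Lemma le_integral_real (R : realType) (d : measure_display)
    (Omega : measurableType d) (P : probability Omega R) (f g : Omega -> R) :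
  measurable_fun setT f -> measurable_fun setT g ->
  (forall w, 0 <= f w) -> (forall w, f w <= g w) ->
  (\int[P]_w (f w)%:E <= \int[P]_w (g w)%:E)%E.
Proof.
move=> mf mg f0 fg; apply: ge0_le_integral => //.
- by move=> w _; rewrite lee_fin.
- exact: measurable_EFin.
- exact: measurable_EFin.
- by move=> w _; rewrite lee_fin.
Qed.

Lemma measurable_norm_powR (R : realType) (p : R) :
  measurable_fun setT (fun x : R => `|x| `^ p).
Proof. exact: measurableT_comp (measurable_powR p) (@normr_measurable R setT). Qed.

Lemma measurable_neg_pow (R : realType) (p : R) :
  measurable_fun setT (@neg_pow R p).
Proof.
apply: (measurableT_comp (measurable_powR p)).
by apply: measurable_maxr => //; exact: oppr_measurable.
Qed.

Definition gaussian_mgf (R : realType) (d : measure_display)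
    (Omega : measurableType d) (P : probability Omega R) (U : Omega -> R)
    (s : R) : Prop :=
  forall t : R, (\int[P]_w (expR (t * U w))%:E = (expR (t ^+ 2 / 2 * s))%:E)%E.

Definition abs_moment (R : realType) (d : measure_display)
    (Omega : measurableType d) (P : probability Omega R) (p : R)
    (U : Omega -> R) : R := fine (\int[P]_w (`|U w| `^ p)%:E)%E.

Lemma integral_expR_powR (R : realType) (d : measure_display)
    (Omega : measurableType d) (P : probability Omega R) (U : Omega -> R)
    (p s c : R) : 0 < p -> p <= 1 -> measurable_fun setT U ->
  gaussian_mgf P U s -> s <= 1 -> 0 <= c ->
  (\int[P]_w (expR (c * `|U w| `^ p))%:E <= (2 * expR (c + c ^+ 2 / 2))%:E)%E.
Proof.
move=> p0 p1 mU mgf s1 c0.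
have mexp a : measurable_fun setT (fun w => expR (a * U w)).
  exact: measurableT_comp (measurable_expRM a) mU.
apply: (@le_trans _ _
    (\int[P]_w (0 + expR c * expR (c * U w) + expR c * expR (- c * U w))%:E)%E).
  apply: le_integral_real => [|||w]; last 1 first.
  - rewrite add0r -mulrDr mulNr; apply: le_trans (_ : expR c * expR `|c * U w| <= _).
      rewrite -expRD ler_expR normrM (ger0_norm c0) -[X in X + _]mulr1 -mulrDr.
      by rewrite ler_wpM2l// powR_le_1D.
    by rewrite ler_wpM2l ?expR_ge0// expR_norm_le.
  - apply: measurableT_comp (measurable_expRM c) _.
    exact: measurableT_comp (measurable_norm_powR p) mU.
  - apply: measurable_funD.
      apply: measurable_funD; first exact: measurable_cst.
      exact: measurableT_comp (mulrl_measurable _) (mexp c).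
    exact: measurableT_comp (mulrl_measurable _) (mexp (- c)).
  - by move=> w; exact: expR_ge0.
rewrite integral_affine ?expR_ge0//.
rewrite !mgf -!EFinM -!EFinD lee_fin add0r sqrrN -mulrDr.
set e := expR (c ^+ 2 / 2 * s); have : e <= expR (c ^+ 2 / 2).
  by rewrite ler_expR ler_piMr// divr_ge0// sqr_ge0.
by rewrite expRD; have := expR_ge0 c; nra.
Qed.

Lemma abs_momentE (R : realType) (d : measure_display)
    (Omega : measurableType d) (P : probability Omega R) (U : Omega -> R)
    (p s : R) : 0 < p -> p <= 1 -> measurable_fun setT U ->
  gaussian_mgf P U s -> s <= 1 ->
  (\int[P]_w (`|U w| `^ p)%:E = (abs_moment P p U)%:E)%E.
Proof.
move=> p0 p1 mU mgf s1; rewrite /abs_moment fineK//.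
rewrite ge0_fin_numE; last by apply: integral_ge0 => w _; rewrite lee_fin powR_ge0.
have := integral_expR_powR p0 p1 mU mgf s1 ler01.
move=> /le_lt_trans -/(_ _ (ltry _)); apply: le_lt_trans.
apply: le_integral_real => [|||w].
- exact: measurableT_comp (measurable_norm_powR p) mU.
- apply: measurableT_comp (measurable_expRM 1) _.
  exact: measurableT_comp (measurable_norm_powR p) mU.
- by move=> w; exact: powR_ge0.
- by rewrite mul1r; apply: le_trans (expR_ge1Dx _); rewrite lerDr.
Qed.

(** Integrate [cosh_le_powR]: the left side has mean [2 * expR (s / 2) >= 2 + 1/4], while the [eta]
    term on the right has mean [2 * eta * expR (2 * s) <= 1/8]. The moment must supply the missing
    1/8. *)
Lemma abs_moment_lb (R : realType) (d : measure_display)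
    (Omega : measurableType d) (P : probability Omega R) (U : Omega -> R)
    (p s eta : R) : 0 < p -> p <= 1 -> measurable_fun setT U ->
  gaussian_mgf P U s -> 4^-1 <= s -> s <= 1 -> 0 < eta ->
  eta * expR 2 <= 16^-1 ->
  8^-1 <= (eta^-1 + 1) * abs_moment P p U.
Proof.
move=> p0 p1 mU mgf s4 s1 e0 e16.
have mexp a : measurable_fun setT (fun w => expR (a * U w)).
  exact: measurableT_comp (measurable_expRM a) mU.
have my : measurable_fun setT (fun w => `|U w| `^ p).
  exact: measurableT_comp (measurable_norm_powR p) mU.
have mcosh : measurable_fun setT (fun w => expR (2 * U w) + expR (- 2 * U w)).
  exact: measurable_funD.
have : (\int[P]_w (0 + 1 * expR (1 * U w) + 1 * expR (- 1 * U w))%:E <=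
    \int[P]_w (2 + (eta^-1 + 1) * `|U w| `^ p +
      eta * (expR (2 * U w) + expR (- 2 * U w)))%:E)%E.
  apply: le_integral_real => [|||w].
  - apply: measurable_funD.
      apply: measurable_funD; first exact: measurable_cst.
      exact: measurableT_comp (mulrl_measurable _) (mexp 1).
    exact: measurableT_comp (mulrl_measurable _) (mexp (- 1)).
  - apply: measurable_funD.
      apply: measurable_funD; first exact: measurable_cst.
      exact: measurableT_comp (mulrl_measurable _) my.
    exact: measurableT_comp (mulrl_measurable _) mcosh.
  - by move=> w; rewrite add0r !mul1r addr_ge0// expR_ge0.
  - rewrite add0r !mul1r mulN1r mulNr; exact: cosh_le_powR.
have K0 : 0 <= eta^-1 + 1 by rewrite addr_ge0// invr_ge0 ltW.
have y0 w : 0 <= `|U w| `^ p by exact: powR_ge0.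
have cosh0 w : 0 <= expR (2 * U w) + expR (- 2 * U w).
  by rewrite addr_ge0// expR_ge0.
rewrite integral_affine// (integral_affine P my mcosh y0 cosh0 _ K0 (ltW e0))//.
have -> : (\int[P]_w (expR (2 * U w) + expR (- 2 * U w))%:E =
    (2 * expR (2 * s))%:E)%E.
  under eq_integral do rewrite EFinD.
  rewrite ge0_integralD//; first last.
  - exact: measurable_EFin.
  - exact: measurable_EFin.
  rewrite !mgf -EFinD sqrrN; congr EFin.
  rewrite (_ : 2 ^+ 2 / 2 = 2); last by field.
  by rewrite -mulr2n mulr_natl.
rewrite (abs_momentE p0 p1 mU mgf s1) !mgf -!EFinM -!EFinD lee_fin.
rewrite sqrrN expr1n add0r !mul1r.
have : eta * expR (2 * s) <= eta * expR 2 by rewrite ler_pM2l// ler_expR; lra.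
by have := expR_ge1Dx (2^-1 * s); lra.
Qed.

Lemma expR_neg_pow_pair (R : realType) (p t r u : R) : 0 < p ->
  r = -1 \/ r = 1 ->
  expR (t * neg_pow p (r * u)) + expR (t * neg_pow p (- (r * u))) =
  1 + expR (t * `|u| `^ p).
Proof.
move=> p0 r1.
have <- : `|r * u| = `|u| by case: r1 => ->; rewrite ?mul1r// mulN1r normrN.
move: (r * u) => v; rewrite -neg_pow_add//; have [v0|v0] := leP 0 v.
  have -> : neg_pow p v = 0.
    by rewrite /neg_pow max_r ?oppr_le0// powR0// gt_eqF.
  by rewrite add0r mulr0 expR0.
have -> : neg_pow p (- v) = 0.
  by rewrite /neg_pow opprK max_r ?ltW// powR0// gt_eqF.
by rewrite addr0 mulr0 expR0 addrC.
Qed.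

Lemma sqr_le_expR3 (R : realType) (y : R) : 0 <= y -> y ^+ 2 <= expR (3 * y).
Proof.
move=> y0; apply: le_trans (sqr_le_expR y0) _.
by rewrite ler_expR ler_wpM2r// ler_nat.
Qed.

(** The remainder [y ^+ 2 * expR (t * y)] is absorbed by [expR (3 * y)], whose mean is bounded
    independently of [t]. *)
Lemma expRM_le_quadratic (R : realType) (t y : R) : 0 <= t -> t <= 1 -> 0 <= y ->
  expR (t * y) <= 1 + t * y + t ^+ 2 * expR (3 * y).
Proof.
move=> t0 t1 y0; apply: le_trans (expR_le_quadratic (mulr_ge0 t0 y0)) _.
rewrite lerD2l exprMn -mulrA; apply: ler_wpM2l; first exact: sqr_ge0.
have -> : 3 * y = 2 * y + y by ring.
rewrite expRD; apply: ler_pM; [exact: sqr_ge0|exact: expR_ge0|exact: sqr_le_expR|].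
by rewrite ler_expR ler_piMl.
Qed.

Lemma expRNM_le_quadratic (R : realType) (t y : R) : 0 <= t -> 0 <= y ->
  expR (- t * y) + t * y <= 1 + t ^+ 2 * expR (3 * y).
Proof.
move=> t0 y0; have := expRN_le_quadratic (mulr_ge0 t0 y0).
rewrite exprMn mulNr.
have : t ^+ 2 * y ^+ 2 <= t ^+ 2 * expR (3 * y).
  by apply: ler_wpM2l; [exact: sqr_ge0|exact: sqr_le_expR3].
by lra.
Qed.

Lemma le_half (R : realType) (x : \bar R) (a : R) :
  (x + x <= (2 * a)%:E -> x <= a%:E)%E.
Proof.
by case: x => [x| |]; rewrite ?leNye// -?EFinD ?lee_fin// => ?; lra.
Qed.

(** As [f] and [g] have equal integrals, twice the integral of [f] is that of [1 + h]. *)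
Lemma integral_half (R : realType) (d : measure_display)
    (Omega : measurableType d) (P : probability Omega R) (f g h : Omega -> R)
    (c : R) : measurable_fun setT f -> measurable_fun setT g ->
  measurable_fun setT h ->
  (forall w, 0 <= f w) -> (forall w, 0 <= g w) -> (forall w, 0 <= h w) ->
  (\int[P]_w (f w)%:E = \int[P]_w (g w)%:E)%E ->
  (forall w, f w + g w = 1 + h w) ->
  (\int[P]_w (h w)%:E <= (1 + 2 * c)%:E)%E ->
  (\int[P]_w (f w)%:E <= (1 + c)%:E)%E.
Proof.
move=> mf mg mh f0 g0 h0 fg fgh hc.
have : (\int[P]_w (f w)%:E + \int[P]_w (f w)%:E <= (2 * (1 + c))%:E)%E.
  have E1 := integral_affine P mf mg f0 g0 (lexx 0) ler01 ler01.
  have E2 := integral_affine P mh mh h0 h0 ler01 ler01 (lexx 0).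
  have -> : (\int[P]_w (f w)%:E + \int[P]_w (f w)%:E =
      \int[P]_w (0 + 1 * f w + 1 * g w)%:E)%E by rewrite E1 -fg add0e !mul1e.
  have -> : (\int[P]_w (0 + 1 * f w + 1 * g w)%:E =
      \int[P]_w (1 + 1 * h w + 0 * h w)%:E)%E.
    apply: eq_integral => w _; congr (_%:E).
    by rewrite add0r !mul1r mul0r addr0.
  rewrite E2 mul1e mul0e adde0.
  have -> : 2 * (1 + c) = 1 + (1 + 2 * c) by ring.
  by rewrite EFinD leeD2l.
by move=> /le_half.
Qed.

Lemma integral_le_subr (R : realType) (d : measure_display)
    (Omega : measurableType d) (P : probability Omega R) (f y g : Omega -> R)
    (t a b m : R) : measurable_fun setT f -> measurable_fun setT y ->
  measurable_fun setT g ->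
  (forall w, 0 <= f w) -> (forall w, 0 <= y w) -> (forall w, 0 <= g w) ->
  0 <= t -> 0 <= a -> (\int[P]_w (y w)%:E = m%:E)%E ->
  (\int[P]_w (g w)%:E <= b%:E)%E ->
  (forall w, f w + t * y w <= 1 + a * g w) ->
  (\int[P]_w (f w)%:E <= (1 - t * m + a * b)%:E)%E.
Proof.
move=> mf my mg f0 y0 g0 t0 a0 ym gb fyg.
have E1 := integral_affine P mf my f0 y0 (lexx 0) ler01 t0.
have E2 := integral_affine P my mg y0 g0 ler01 (lexx 0) a0.
have : (\int[P]_w (f w)%:E + (t * m)%:E <= (1 + a * b)%:E)%E.
  have -> : (\int[P]_w (f w)%:E + (t * m)%:E =
      \int[P]_w (0 + 1 * f w + t * y w)%:E)%E by rewrite E1 add0e mul1e ym EFinM.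
  apply: le_trans (_ : (\int[P]_w (1 + 0 * y w + a * g w)%:E <= _)%E).
    apply: le_integral_real => [|||w].
    - apply: measurable_funD.
        apply: measurable_funD; first exact: measurable_cst.
        exact: measurableT_comp (mulrl_measurable _) mf.
      exact: measurableT_comp (mulrl_measurable _) my.
    - apply: measurable_funD.
        apply: measurable_funD; first exact: measurable_cst.
        exact: measurableT_comp (mulrl_measurable _) my.
      exact: measurableT_comp (mulrl_measurable _) mg.
    - by move=> w; rewrite add0r mul1r addr_ge0// mulr_ge0.
    - by rewrite add0r mul1r mul0r addr0.
  by rewrite E2 mul0e adde0 EFinD leeD2l// EFinM lee_wpmul2l// lee_fin.
rewrite -leeBrDr// -EFinB => /le_trans; apply; rewrite lee_fin; lra.
Qed.

Lemma integral_le_addl (R : realType) (d : measure_display)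
    (Omega : measurableType d) (P : probability Omega R) (f y g : Omega -> R)
    (t a b m : R) : measurable_fun setT f -> measurable_fun setT y ->
  measurable_fun setT g ->
  (forall w, 0 <= f w) -> (forall w, 0 <= y w) -> (forall w, 0 <= g w) ->
  0 <= t -> 0 <= a -> (\int[P]_w (y w)%:E = m%:E)%E ->
  (\int[P]_w (g w)%:E <= b%:E)%E ->
  (forall w, f w <= 1 + t * y w + a * g w) ->
  (\int[P]_w (f w)%:E <= (1 + t * m + a * b)%:E)%E.
Proof.
move=> mf my mg f0 y0 g0 t0 a0 ym gb fyg.
have E := integral_affine P my mg y0 g0 ler01 t0 a0.
apply: le_trans (_ : (\int[P]_w (1 + t * y w + a * g w)%:E <= _)%E).
  apply: le_integral_real => //; apply: measurable_funD.
    apply: measurable_funD; first exact: measurable_cst.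
    exact: measurableT_comp (mulrl_measurable _) my.
  exact: measurableT_comp (mulrl_measurable _) mg.
by rewrite E ym -EFinM !EFinD leeD2l// EFinM lee_wpmul2l// lee_fin.
Qed.

(* Even the sign-restricted loss gains half of the moment: under the symmetry of
   [U] the two signs share [expR (t * |U| `^ p) + 1] equally. *)
Lemma integral_expR_loss (R : realType) (d : measure_display)
    (Omega : measurableType d) (P : probability Omega R) (U : Omega -> R)
    (p s t r : R) (b : bool) : 0 < p -> p <= 1 -> measurable_fun setT U ->
  gaussian_mgf P U s -> s <= 1 -> 0 <= t -> t <= 1 ->
  same_law P U (fun w => - U w) -> r = -1 \/ r = 1 ->
  (\int[P]_w (expR (- t * loss p b r (U w)))%:E <=
   (expR (t * abs_moment P p U * (if b then 2^-1 else -1)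
          + t ^+ 2 * (2 * expR (3 + 3 ^+ 2 / 2))))%:E)%E.
Proof.
move=> p0 p1 mU mgf s1 t0 t1 sym r1.
have I3 := integral_expR_powR p0 p1 mU mgf s1 (ler0n R 3).
have muE := abs_momentE p0 p1 mU mgf s1.
have C0 : 0 <= 2 * expR (3 + 3 ^+ 2 / 2) :> R by rewrite mulr_ge0// expR_ge0.
move: (2 * expR _) C0 I3 => C C0 I3; move: (abs_moment P p U) muE => mu muE.
have my : measurable_fun setT (fun w => `|U w| `^ p).
  exact: measurableT_comp (measurable_norm_powR p) mU.
have mexp a : measurable_fun setT (fun w => expR (a * `|U w| `^ p)).
  exact: measurableT_comp (measurable_expRM a) my.
have y0 w : 0 <= `|U w| `^ p by exact: powR_ge0.
have e0 a w : 0 <= expR (a * `|U w| `^ p) by exact: expR_ge0.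
have t20 : 0 <= t ^+ 2 by exact: sqr_ge0.
case: b.
- have mn e : measurable_fun setT (fun x : R => expR (t * neg_pow p (e * x))).
    apply: measurableT_comp (measurable_expRM t) _.
    exact: measurableT_comp (measurable_neg_pow p) (mulrl_measurable e).
  pose f e w := expR (t * neg_pow p (e * U w)).
  have mf e : measurable_fun setT (f e) by exact: measurableT_comp (mn e) mU.
  have f0 e w : 0 <= f e w by exact: expR_ge0.
  have -> : (\int[P]_w (expR (- t * loss p true r (U w)))%:E = \int[P]_w (f r w)%:E)%E.
    by apply: eq_integral => w _; rewrite /loss mulrNN.
  have ff : (\int[P]_w (f r w)%:E = \int[P]_w (f (- r) w)%:E)%E.
    have := sym (fun x => (expR (t * neg_pow p (r * x)))%:E) (measurable_EFin (mn r)).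
    move=> /(_ (fun x => expR_ge0 _)); rewrite /f => ->.
    by apply: eq_integral => w _; rewrite mulrN mulNr.
  have fp w : f r w + f (- r) w = 1 + expR (t * `|U w| `^ p).
    by rewrite /f mulNr; exact: expR_neg_pow_pair.
  have half := @integral_half _ _ _ P _ _ _ (t * mu / 2 + t ^+ 2 * C / 2)
    (mf r) (mf (- r)) (mexp t) (f0 r) (f0 (- r)) (e0 t) ff fp.
  apply: le_trans (half _) _.
    have -> : 1 + 2 * (t * mu / 2 + t ^+ 2 * C / 2) = 1 + t * mu + t ^+ 2 * C by field.
    apply: (integral_le_addl (mexp t) my (mexp 3) (e0 t) y0 (e0 3) t0 t20 muE I3).
    by move=> w; apply: expRM_le_quadratic t0 t1 (y0 w).
  rewrite lee_fin; apply: le_trans (expR_ge1Dx _).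
  by have := mulr_ge0 t20 C0; lra.
- have le1 : (\int[P]_w (expR (- t * `|U w| `^ p))%:E <= (1 - t * mu + t ^+ 2 * C)%:E)%E.
    apply: (integral_le_subr (mexp (- t)) my (mexp 3) (e0 _) y0 (e0 3) t0 t20 muE I3).
    by move=> w; apply: expRNM_le_quadratic t0 (y0 w).
  apply: le_trans le1 _; rewrite lee_fin; apply: le_trans (expR_ge1Dx _); lra.
Qed.

(** * Concentration *)

Lemma chernoff_bound (R : realType) (d : measure_display)
    (Omega : measurableType d) (P : probability Omega R) (V : Omega -> R)
    (a c : R) : measurable_fun setT V ->
  (\int[P]_w (expR (V w))%:E <= (expR c)%:E)%E ->
  measurable [set w | a <= V w]%classic /\
  (P [set w | (a <= V w)%R]%classic <= (expR (c - a))%:E)%E.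
Proof.
move=> mV Vc; set A := ([set w | a <= V w])%classic.
have mA : measurable A.
  have -> : A = (V @^-1` `[a, +oo[)%classic.
    by apply/seteqP; split=> w; rewrite /A /= in_itv/= andbT.
  by rewrite -[X in measurable X]setTI; exact: mV.
split=> //.
have mexp : measurable_fun setT (fun w => expR (V w)).
  exact: measurableT_comp (@measurable_expR R) mV.
have : (\int[P]_w (\1_A w)%:E <=
    \int[P]_w (0 + expR (- a) * expR (V w) + 0 * expR (V w))%:E)%E.
  apply: le_integral_real => [|||w].
  - exact: measurable_indic.
  - apply: measurable_funD.
      apply: measurable_funD; first exact: measurable_cst.
      exact: measurableT_comp (mulrl_measurable _) mexp.
    exact: measurableT_comp (mulrl_measurable _) mexp.
  - by move=> w; rewrite indicE; case: (_ \in _).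
  - rewrite add0r mul0r addr0 indicE -expRD.
    case: (boolP (w \in A)) => [|_]; last exact: expR_ge0.
    by rewrite inE /A /= => aV; apply: le_trans (expR_ge1Dx _); lra.
have e0 w : 0 <= expR (V w) by exact: expR_ge0.
rewrite (integral_affine P mexp mexp e0 e0 (lexx 0) (expR_ge0 _) (lexx 0)).
rewrite integral_indic// setIT mul0e adde0 add0e => /le_trans; apply.
by rewrite expRD EFinM muleC; apply: lee_wpmul2r.
Qed.

Lemma prode_le (R : realType) (L : finType) (F : L -> \bar R) (e : L -> R) :
  (forall l, 0 <= F l)%E -> (forall l, F l <= (e l)%:E)%E ->
  (\prod_l F l <= (\prod_l e l)%:E)%E.
Proof.
move=> F0 Fe.
suff : (0 <= \prod_l F l <= (\prod_l e l)%:E)%E by case/andP.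
apply: (big_ind2 (fun x y => 0 <= x <= y%:E)%E) => [|x a y b|l _].
- by rewrite lexx lee_fin ler01.
- move=> /andP[x0 xa] /andP[y0 yb]; rewrite mule_ge0//= EFinM.
  exact: lee_pmul.
- by rewrite F0 Fe.
Qed.

(** Written over [index_enum] to coincide with the index set that [determined_lincomb] produces for
    a full row. *)
Definition row_cells (m n : nat) (i : 'I_m) : {set 'I_m * 'I_n} :=
  [set (i, j) | j in index_enum 'I_n]%SET.

Lemma row_cells_disjoint (m n : nat) (i k : 'I_m) :
  i != k -> [disjoint row_cells n i & row_cells n k].
Proof.
move=> ik; rewrite -setI_eq0; apply/eqP/finset.setP => x; rewrite !inE.
apply/negP => /andP[/imsetP[j _ ->] /imsetP[l _ [kE _]]].
by rewrite kE eqxx in ik.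
Qed.

Section rows.
Context (R : realType) (d : measure_display) (Omega : measurableType d)
  (P : probability Omega R) (m n : nat) (X : 'I_m * 'I_n -> {RV P >-> R})
  (z : 'cV[R]_n).

Definition row_form (i : 'I_m) (w : Omega) : R := (random_mx X w *m z) i ord0.

Lemma row_formE i :
  row_form i = fun w => \sum_j z j ord0 * X (i, j) w.
Proof.
apply/funext => w; rewrite /row_form mxE; apply: eq_bigr => j _.
by rewrite mxE mulrC.
Qed.

Lemma row_form_determined i : determined_by X (row_cells n i) (row_form i).
Proof. by rewrite row_formE; exact: determined_lincomb. Qed.

Lemma row_form_measurable i : measurable_fun setT (row_form i).
Proof.
have dU : determined_by X (row_cells n i) (row_form i).
  exact: row_form_determined.
exact: determined_measurable dU.
Qed.

(** One statement for two facts: [k = i], [s = -1] is the symmetry of a row, and [s = 1] says that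
    all rows share a law. *)
Lemma row_form_same_law i k (s : R) : iid_std_normal X -> s = -1 \/ s = 1 ->
  same_law P (row_form i) (fun w => s * row_form k w).
Proof.
move=> [indep lX] s1; rewrite !row_formE.
rewrite (_ : (fun w => s * _) = fun w => \sum_j (s * z j ord0) * X (k, j) w); last first.
  by apply/funext => w; rewrite mulr_sumr; apply: eq_bigr => j _; rewrite mulrA.
apply: (same_law_lincomb (f := fun j => (i, j)) (g := fun j => (k, j))) => //.
- by move=> j l [].
- by move=> j l [].
- by move=> j; exact: same_law_std_normal.
Qed.

Lemma row_form_mgf i : iid_std_normal X -> gaussian_mgf P (row_form i) (sqnorm z).
Proof.
move=> iid t; rewrite row_formE.
by apply: (lincomb_mgf (f := fun j => (i, j))) => // j l [].
Qed.

Lemma row_form_abs_moment (p : R) i k : iid_std_normal X ->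
  abs_moment P p (row_form i) = abs_moment P p (row_form k).
Proof.
move=> iid; rewrite /abs_moment; congr fine.
have := row_form_same_law i k iid (or_intror erefl).
move=> /(_ (fun x => (`|x| `^ p)%:E) (measurable_EFin (measurable_norm_powR p))).
move=> /(_ (fun x => powR_ge0 _ _)) ->.
by apply: eq_integral => w _; rewrite mul1r.
Qed.

Lemma integral_expR_rows (phi : 'I_m -> R -> R) (c : 'I_m -> R) :
  iid_std_normal X -> (forall i, measurable_fun setT (phi i)) ->
  (forall i, \int[P]_w (expR (phi i (row_form i w)))%:E <= (expR (c i))%:E)%E ->
  (\int[P]_w (expR (\sum_i phi i (row_form i w)))%:E <= (expR (\sum_i c i))%:E)%E.
Proof.
move=> [indep _] mphi le_c; under eq_integral => w _ do rewrite expR_sum.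
have := @integral_indep_prod _ _ _ P _ X _ (@row_cells m n)
  (fun i w => expR (phi i (row_form i w))) indep.
move=> ->.
- rewrite expR_sum; apply: prode_le => // i.
  by apply: integral_ge0 => w _; rewrite lee_fin expR_ge0.
- exact: row_cells_disjoint.
- move=> i; apply: (determined_comp (f := fun x => expR (phi i x))).
    exact: measurableT_comp (@measurable_expR R) (mphi i).
  exact: row_form_determined.
- by move=> i w; exact: expR_ge0.
Qed.

Lemma lpp_tail (p : R) : 0 < p -> p <= 1 -> iid_std_normal X -> sqnorm z <= 1 ->
  let A := [set w | 4 * m%:R <= lpp p (random_mx X w *m z)]%classic in
  measurable A /\ (P A <= (expR (- m%:R))%:E)%E.
Proof.
move=> p0 p1 iid z1 /=.
have le2 : 2 <= expR 1 :> R by apply: le_trans (expR_ge1Dx _).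
(* Each row contributes at most [2 * expR (3/2) <= expR 3], so the threshold [4 * m] leaves the
   exponent [3 * m - 4 * m]. *)
have E i : (\int[P]_w (expR (`|row_form i w| `^ p))%:E <= (expR 3)%:E)%E.
  have := integral_expR_powR p0 p1 (row_form_measurable i) (row_form_mgf i iid) z1 ler01.
  under eq_integral do rewrite mul1r.
  move=> /le_trans; apply; rewrite lee_fin.
  apply: (@le_trans _ _ (expR 1 * expR (1 + 1 ^+ 2 / 2))).
    by rewrite ler_wpM2r// expR_ge0.
  by rewrite -expRD ler_expR; lra.
have := @integral_expR_rows (fun=> fun x => `|x| `^ p) (fun=> 3) iid
  (fun=> measurable_norm_powR p) E.
rewrite sumr_const card_ord => /(chernoff_bound (4 * m%:R)) [|mA PA].
  apply: measurable_sum => i.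
  exact: measurableT_comp (measurable_norm_powR p) (row_form_measurable i).
split=> //; apply: le_trans PA _.
by rewrite lee_fin ler_expR -[3 *+ m]mulr_natr; lra.
Qed.

Lemma total_loss_tail (p kappa mu t : R) (T : {set 'I_m}) (sigma : 'I_m -> R) :
  0 < p -> p <= 1 -> iid_std_normal X -> sqnorm z <= 1 -> 0 < t -> t <= 1 ->
  (forall i, i \in T -> sigma i = -1 \/ sigma i = 1) ->
  0 <= kappa -> #|T|%:R * (3 / 2) <= (1 - kappa) * m%:R ->
  0 <= mu -> (forall i, mu <= abs_moment P p (row_form i)) ->
  let C := 2 * expR (3 + 3 ^+ 2 / 2) in
  let A := [set w | total_loss p T sigma (random_mx X w *m z) <=
                      mu * kappa / 2 * m%:R]%classic in
  measurable A /\
  (P A <= (expR (- (t * (mu * kappa / 2 - t * C)) * m%:R))%:E)%E.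
Proof.
move=> p0 p1 iid z1 t_gt0 t1 s1 k0 Tk mu0 muP; have t0 := ltW t_gt0.
set C := 2 * _ => /=.
have mloss i : measurable_fun setT (fun x : R => - t * loss p (i \in T) (sigma i) x).
  apply: measurableT_comp (mulrl_measurable (- t)) _; rewrite /loss.
  case: (i \in T); last exact: measurable_norm_powR.
  apply: measurableT_comp (@oppr_measurable R setT) _.
  exact: measurableT_comp (measurable_neg_pow p) (mulrl_measurable _).
pose c i := t * abs_moment P p (row_form i) * (if i \in T then 2^-1 else -1) + t ^+ 2 * C.
have E i : (\int[P]_w (expR (- t * loss p (i \in T) (sigma i) (row_form i w)))%:E <=
    (expR (c i))%:E)%E.
  have sym : same_law P (row_form i) (fun w => - row_form i w).
    have -> : (fun w => - row_form i w) = (fun w => -1 * row_form i w).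
      by apply/funext => w; rewrite mulN1r.
    by apply: row_form_same_law => //; left.
  have IL' r b := @integral_expR_loss _ _ _ P _ p _ t r b p0 p1
    (row_form_measurable i) (row_form_mgf i iid) z1 t0 t1 sym.
  rewrite /c; have [iT|iT] := boolP (i \in T); first exact: (IL' _ true (s1 i iT)).
  exact: (IL' 1 false (or_intror erefl)).
(* The linear terms add up to [t * M * (3/2 * #|T| - m)], at most [- t * M * kappa * m]. A row [i0]
   is needed to name the common moment [M], so [m = 0] is treated apart. *)
have csum : \sum_i c i <= - (t * mu * kappa * m%:R) + t ^+ 2 * C * m%:R.
  rewrite /c big_split/= sumr_const card_ord -[_ *+ m]mulr_natr lerD2r.
  have [i0 _|no] := pickP 'I_m; last first.
    have m0 : m = 0%N by case: (m) no => // m' /(_ ord0).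
    by rewrite big1 => [|i]; [rewrite m0 mulr0 oppr0|have := no i].
  pose M := abs_moment P p (row_form i0).
  have -> : \sum_i t * abs_moment P p (row_form i) * (if i \in T then 2^-1 else -1) =
      t * M * (#|T|%:R * (3 / 2) - m%:R).
    rewrite (eq_bigr (fun i => t * M * ((if i \in T then 3 / 2 else 0) - 1))); last first.
      move=> i _; rewrite (row_form_abs_moment p i i0)//; congr (_ * _).
      by case: (i \in T); field.
    rewrite -mulr_sumr big_split/= -big_mkcond/= sumr_const sumrN sumr_const card_ord.
    by rewrite -[_ *+ #|T|]mulr_natl.
  have M0 : 0 <= M by apply: le_trans mu0 (muP i0).
  have : t * M * (#|T|%:R * (3 / 2) - m%:R) <= t * M * (- (kappa * m%:R)).
    by rewrite ler_wpM2l ?mulr_ge0//; lra.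
  have : t * mu * (kappa * m%:R) <= t * M * (kappa * m%:R).
    by rewrite ler_wpM2r ?mulr_ge0// ler_wpM2l// muP.
  lra.
have := integral_expR_rows iid mloss E.
have -> : (\int[P]_w (expR (\sum_i - t * loss p (i \in T) (sigma i) (row_form i w)))%:E =
    \int[P]_w (expR (- t * total_loss p T sigma (random_mx X w *m z)))%:E)%E.
  by apply: eq_integral => w _; rewrite -mulr_sumr.
move=> Ic.
have mV : measurable_fun setT
    (fun w => - t * total_loss p T sigma (random_mx X w *m z)).
  rewrite (_ : (fun w => _) =
      fun w => \sum_i - t * loss p (i \in T) (sigma i) (row_form i w)).
    apply: measurable_sum => i.
    exact: measurableT_comp (mloss i) (row_form_measurable i).
  by apply/funext => w; rewrite -mulr_sumr.
(* The threshold is half of the guaranteed drift; the other half pays for the quadratic term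
   [t ^+ 2 * C * m]. *)
have [] := chernoff_bound (- t * (mu * kappa / 2 * m%:R)) mV Ic.
have -> : [set w | - t * (mu * kappa / 2 * m%:R) <=
      - t * total_loss p T sigma (random_mx X w *m z)]%classic =
    [set w | total_loss p T sigma (random_mx X w *m z) <=
      mu * kappa / 2 * m%:R]%classic.
  by apply/seteqP; split=> w /=; rewrite ler_nM2l ?oppr_lt0.
move=> mA PA; split=> //; apply: le_trans PA _.
by rewrite lee_fin ler_expR; lra.
Qed.

End rows.

(** * Conclusion *)

Lemma exists_mesh (R : realType) (p x : R) : 0 < p -> 0 < x ->
  exists q : nat, (1 < q)%N /\ (q%:R^-1 : R) `^ p <= x.
Proof.
move=> p0 x0; pose y := x `^ p^-1; have y0 : 0 < y by rewrite powR_gt0.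
(* One successor puts [q] above [y^-1], the second makes it at least 2. *)
pose q := (Num.truncn y^-1).+2; exists q; split=> //.
have -> : x = y `^ p by rewrite /y -powRrM mulVf ?gt_eqF// powRr1// ltW.
apply: ge0_ler_powR; rewrite ?nnegrE ?invr_ge0 ?ler0n ?(ltW p0) ?(ltW y0)//.
rewrite -[leRHS]invrK lef_pV2 ?posrE ?invr_gt0 ?ltr0n//.
apply/ltW/(lt_trans (truncnS_gt _)); by rewrite ltr_nat.
Qed.

Lemma union_bound (R : realType) (d : measure_display)
    (Omega : measurableType d) (P : probability Omega R) (L : Type) (s : seq L)
    (A : L -> set Omega) (e : R) :
  (forall l, measurable (A l)) -> (forall l, P (A l) <= e%:E)%E ->
  (P (\big[setU/set0]_(l <- s) A l) <= ((size s)%:R * e)%:E)%E.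
Proof.
move=> mA PA; elim: s => [|l s IH]; first by rewrite big_nil measure0 mul0r.
rewrite big_cons /= -natr1 mulrDl mul1r addrC EFinD.
apply: le_trans (leeD (PA l) IH); apply: measureU2 => //.
by apply: bigsetU_measurable.
Qed.

(** [abs_moment_lb] at the largest admissible [eta], namely [(16 * expR 2)^-1]; the bound is the
    same for all [z] in the annulus. *)
Lemma iid_abs_moment_lb (R : realType) (d : measure_display)
    (Omega : measurableType d) (P : probability Omega R) (m n : nat)
    (X : 'I_m * 'I_n -> {RV P >-> R}) (z : 'cV[R]_n) (p : R) (i : 'I_m) :
  0 < p -> p <= 1 -> iid_std_normal X -> 4^-1 <= sqnorm z -> sqnorm z <= 1 ->
  (8 * (16 * expR 2 + 1))^-1 <= abs_moment P p (row_form X z i).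
Proof.
move=> p0 p1 iid z4 z1.
have e2 := expR_gt0 (2 : R).
have := @abs_moment_lb _ _ _ P _ p _ (16 * expR 2)^-1 p0 p1
  (row_form_measurable X z i) (row_form_mgf z i iid) z4 z1.
rewrite invrK invr_gt0 mulr_gt0// invfM -mulrA mulVf ?gt_eqF// mulr1.
move=> /(_ isT (lexx _)); rewrite invfM => h.
by rewrite ler_pdivrMr ?addr_gt0 ?mulr_gt0// mulrC.
Qed.

Theorem theorem4 (R : realType) (p rho : R)
    (hp0 : 0 < p) (hp1 : p < 1) (hrho : rho < 2%:R / 3%:R) :
  exists c7 c8 : R, 0 < c7 /\ 0 < c8 /\
  exists n0 : nat, forall n m : nat,
    (n0 <= n)%N -> c7 * n%:R <= m%:R ->
    forall (T : {set 'I_m}) (sigma : 'I_m -> R),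
      #|T|%:R <= rho * m%:R ->
      (forall i, i \in T -> sigma i = -1 \/ sigma i = 1) ->
    forall (d : measure_display) (Omega : measurableType d)
      (P : probability Omega R) (A : 'I_m * 'I_n -> {RV P >-> R}),
      iid_std_normal A ->
      with_prob_at_least P (1 - expR (- (c8 * n%:R)))
        (fun w => exact_recovery p T sigma (random_mx A w)).
Proof.
have p1 := ltW hp1.
(* The relative drift, positive exactly when [rho < 2/3]. *)
pose kappa := 1 - rho * (3 / 2); have k0 : 0 < kappa by rewrite /kappa; lra.
pose mu : R := (8 * (16 * expR 2 + 1))^-1.
have mu0 : 0 < mu by rewrite invr_gt0 mulr_gt0// addr_gt0// mulr_gt0// expR_gt0.
pose C : R := 2 * expR (3 + 3 ^+ 2 / 2).
have C0 : 0 < C by rewrite mulr_gt0// expR_gt0.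
have mk0 : 0 < mu * kappa by rewrite mulr_gt0.
(* Small enough that the quadratic cost [t * C] takes at most half of the gain [mu * kappa / 2]. *)
pose t := Num.min 1 (mu * kappa / (4 * C)).
have t0 : 0 < t by rewrite lt_min ltr01/= divr_gt0// mulr_gt0.
have t1 : t <= 1 by rewrite ge_min lexx.
have tC : t * C <= mu * kappa / 4.
  have -> : mu * kappa / 4 = mu * kappa / (4 * C) * C.
    by field; rewrite gt_eqF.
  by rewrite ler_pM2r// ge_min lexx orbT.
(* A common exponential rate for the two kinds of bad event. *)
pose c := Num.min 1 (t * (mu * kappa / 4)).
have c0 : 0 < c by rewrite lt_min ltr01/= mulr_gt0// divr_gt0.
have c1 : c <= 1 by rewrite ge_min lexx.
have ct : c <= t * (mu * kappa / 2 - t * C).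
  rewrite (@le_trans _ _ (t * (mu * kappa / 4)))//.
    by rewrite ge_min lexx orbT.
  by rewrite ler_pM2l//; lra.
have [|q [q2 qx]] := exists_mesh (x := Num.min 2^-1 (mu * kappa / 2 / 8)) hp0.
  by rewrite lt_min invr_gt0 ltr0n/= !divr_gt0.
have {qx}[qx1 qx2] : (q%:R^-1 : R) `^ p <= 2^-1 /\
    (q%:R^-1 : R) `^ p <= mu * kappa / 2 / 8.
  by move: qx; rewrite le_min => /andP.
have q0 : (0 < q)%N by apply: ltn_trans q2.
(* The failure probability is at most [2 ^ ((q + 2) * n) * 2 * expR (- (c * m))]. Bounding 2 by
   [expR 1] and using [n >= 1], the exponent is at most [(q + 2) * n + n - (q + 4) * n = - n]. *)
exists ((q%:R + 4) / c), 1; split; first by rewrite divr_gt0// addr_gt0// ltr0n.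
split=> //; exists 1%N => n m n0 hm T sigma hT s1 d Omega P X iid.
have cm : (q%:R + 4) * n%:R <= c * m%:R.
  by move: hm; rewrite mulrAC ler_pdivrMr// [m%:R * c]mulrC.
have n1 : 1 <= n%:R :> R by rewrite ler1n.
have [N [sizeN netN]] := @ball_net R q n q0 n0.
pose lin w (z : 'cV[R]_n) := random_mx X w *m z.
(* The norm conditions sit inside the events, which are thus empty for the other points, so that the
   probability bounds hold for every [z], as [union_bound] requires. *)
pose bad1 z := [set w | sqnorm z <= 1 /\ 4 * m%:R <= lpp p (lin w z)]%classic.
pose bad2 z := [set w | (4^-1 <= sqnorm z /\ sqnorm z <= 1) /\
  total_loss p T sigma (lin w z) <= mu * kappa / 2 * m%:R]%classic.
have P1 z : measurable (bad1 z) /\ (P (bad1 z) <= (expR (- (c * m%:R)))%:E)%E.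
  have [z1|z1] := boolP (sqnorm z <= 1); last first.
    have -> : bad1 z = set0 by apply/seteqP; split=> w // -[]; rewrite (negPf z1).
    by rewrite measure0 lee_fin expR_ge0.
  have [mA PA] := lpp_tail hp0 p1 iid z1.
  have -> : bad1 z = [set w | 4 * m%:R <= lpp p (lin w z)]%classic.
    by apply/seteqP; split=> w //= -[].
  split=> //; apply: le_trans PA _; rewrite lee_fin ler_expR lerN2.
  by rewrite ler_piMl.
have P2 z : measurable (bad2 z) /\ (P (bad2 z) <= (expR (- (c * m%:R)))%:E)%E.
  have [/andP[z4 z1]|z1] := boolP ((4^-1 <= sqnorm z) && (sqnorm z <= 1)); last first.
    have -> : bad2 z = set0.
      by apply/seteqP; split=> w // -[[z4 z1']]; rewrite z4 z1' in z1.
    by rewrite measure0 lee_fin expR_ge0.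
  have hT' : #|T|%:R * (3 / 2) <= (1 - kappa) * m%:R by rewrite /kappa; lra.
  have [mA PA] := total_loss_tail hp0 p1 iid z1 t0 t1 s1 (ltW k0) hT' (ltW mu0)
    (fun i => iid_abs_moment_lb i hp0 p1 iid z4 z1).
  have -> : bad2 z =
      [set w | total_loss p T sigma (lin w z) <= mu * kappa / 2 * m%:R]%classic.
    by apply/seteqP; split=> w //= -[].
  split=> //; apply: le_trans PA _; rewrite lee_fin ler_expR mulNr lerN2.
  by rewrite ler_wpM2r.
pose bad z := (bad1 z `|` bad2 z)%classic.
have mbad z : measurable (bad z) by apply: measurableU; [case: (P1 z)|case: (P2 z)].
have Pbad z : (P (bad z) <= (2 * expR (- (c * m%:R)))%:E)%E.
  apply: le_trans (measureU2 _ _ _) _; [by case: (P1 z)|by case: (P2 z)|].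
  rewrite mulr_natl mulr2n EFinD.
  by apply: leeD; [case: (P1 z)|case: (P2 z)].
have mU : measurable (\big[setU/set0]_(z <- N) bad z)%classic.
  exact: bigsetU_measurable.
exists (~` \big[setU/set0]_(z <- N) bad z)%classic; split.
- exact: measurableC.
- move=> w; rewrite -bigcup_seq => nbad.
  have good z : z \in N -> ~ bad z w by move=> zN bz; apply: nbad; exists z.
  apply: exact_recovery_of_total_loss_gt0 => //.
  apply: (@total_loss_gt0_of_net _ p q%:R^-1 (4 * m%:R) (mu * kappa / 2 * m%:R)
    _ _ _ _ _ (fun z => z \in N)) => //.
  + by move=> i /s1[->|->]; rewrite ?normrN normr1.
  + by rewrite invr_gt0 ltr0n.
  + by rewrite lef_pV2 ?posrE ?ltr0n// ler_nat.
  + have -> : 2 * (4 * m%:R) * (q%:R^-1 : R) `^ p = 8 * (q%:R^-1) `^ p * m%:R by ring.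
    by rewrite ler_wpM2r//; lra.
  + move=> z zN z1; rewrite leNgt; apply/negP => /ltW h.
    by apply: (good z zN); left.
  + move=> z zN z4 z1; rewrite ltNge; apply/negP => h.
    by apply: (good z zN); right.
- rewrite probability_setC// EFinB; apply: leeB => //.
  apply: le_trans (union_bound _ mbad Pbad) _; rewrite lee_fin mul1r.
  have le2 : 2 <= expR 1 :> R by apply: le_trans (expR_ge1Dx _).
  apply: (@le_trans _ _ (expR (((q + 2) * n)%:R) * (expR 1 * expR (- (c * m%:R))))).
    apply: ler_pM; [exact: ler0n|by rewrite mulr_ge0// expR_ge0| |].
      apply: (@le_trans _ _ ((2 ^ ((q + 2) * n))%:R)); first by rewrite ler_nat.
      by rewrite natrX -[_%:R in leRHS]mulr1 expRM_natl lerXn2r ?nnegrE ?expR_ge0.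
    by rewrite ler_wpM2r ?expR_ge0.
  rewrite -!expRD ler_expR natrM natrD; lra.
Qed.
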